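(* Assume that: (a) there exists an integer $m_0\ge1$ such that $\mathbb{E}\left[\min_{1\le j\le m_0}|X'_j|\right]<+\infty$; (b) there exists an open set $U\subset\mathbb{R}^d$ containing $\operatorname{supp}(\mu_X)$ such that: (i) the measure $\mu_{X'}(\cdot\cap U)$ has a density $p_{X'}$ with respect to the Lebesgue measure; (ii) $p_{X'}$ is continuous and positive on $U$; (iii) there exist $\kappa\in(0,1]$ and $r_\kappa>0$ such that for any $x\in U$ and any $r\in[0,r_\kappa]$, $\mu_{X'}(B(x,r))\ge\kappa\,p_{X'}(x)\,v_d\,r^d$; (c) with $X\sim\mu_X$, $\mathbb{E}\left[\dfrac{1+|X|^2}{p_{X'}(X)^{2/d}}\right]<+\infty$; (d) $f$ is Lipschitz continuous in $x$, uniformly in $\Theta$, i.e. there is $L\ge0$ with $|f(x,\theta)-f(x',\theta)|\le L|x-x'|$ for all $x,x'\in\mathbb{R}^d$ and $\theta\in\mathbf{\Theta}$; (e) there is $\sigma\ge0$ such that $\mathrm{Var}(f(x,\Theta))\le\sigma^2<+\infty$ for all $x\in\operatorname{supp}(\mu_{X'})$. Let $(k_m)_{m\ge1}$ be a nondecreasing sequence of positive integers with $k_m\le m$, $k_m/m\to0$ and $k_m\sim m^{2/(d+2)}$ as $m\to+\infty$. Then there exists $C\ge0$ such that $$\limsup_{m\to+\infty}\ m^{1/(2+d)}\,\mathbb{E}\left[\left(r(X)-\hat r_m^{(k_m)}(X)\right)^2\right]^{1/2}\le\sigma+C\,\mathbb{E}\left[\frac{1}{p_{X'}(X)^{2/d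}}\right]^{1/2}.$$
   Context: $|\cdot|$ is a fixed norm on $\mathbb{R}^d$ (not necessarily Euclidean), $B(x,r)=\{x':|x-x'|\le r\}$, $v_d$ is the Lebesgue volume of the unit ball of $|\cdot|$. $\mathbf{\Theta}$ is a measurable space and $f:\mathbb{R}^d\times\mathbf{\Theta}\to\mathbb{R}$ is measurable (scalar-valued). $\mu_X,\mu_{X'}$ are probability measures on $\mathbb{R}^d$ and $\mu_\Theta$ a probability measure on $\mathbf{\Theta}$; $\Theta\sim\mu_\Theta$. $(X'_j)_{j\ge1}$ are i.i.d. with law $\mu_{X'}$, $(\Theta_j)_{j\ge1}$ are i.i.d. with law $\mu_\Theta$, $X\sim\mu_X$, and $X$, $(X'_j)_j$, $(\Theta_j)_j$ are independent; $Y'_j=f(X'_j,\Theta_j)$. $\operatorname{supp}(\nu)=\{x\in\mathbb{R}^d:\forall r>0,\ \nu(B(x,r))>0\}$. The regression function is $r(x):=\mathbb{E}[f(x,\Theta)]$, and its $k$-NN estimator from the training set $(X'_j,Y'_j)_{1\le j\le m}$ is $\hat r_m^{(k)}(x)=\frac1k\sum_{l=1}^kY'_{j^{(l)}(x)}$, $k\in\{1,\dots,m\}$, where the indices $1,\dots,m$ are ordered by increasing distance $|x-X'_j|$, ties broken by lowest index, and $j^{(l)}(x)$ is the $l$-th index in this order (so $(j^{(l)}(x))_{1\le l\le m}$ is a permutation of $\{1,\dots,m\}$). *)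

(* Defs.v *)
From HB Require Import structures.
From mathcomp Require Import all_boot all_order all_algebra.
From mathcomp Require Import finmap.
From mathcomp Require Import all_classical all_reals all_analysis.

Set Implicit Arguments.
Unset Strict Implicit.
Unset Printing Implicit Defensive.

Import Order.TTheory GRing.Theory Num.Theory.
Import numFieldNormedType.Exports.

Local Open Scope classical_set_scope.
Local Open Scope ring_scope.

Section borel.
Variables (R : realType) (n : nat).

Let borel : set (set 'rV[R]_n) := <<s open >>.

Let borel0 : borel set0. Proof. exact: sigma_algebra0. Qed.

Let borelC A : borel A -> borel (~` A). Proof. exact: sigma_algebraC. Qed.

Let borelU (F : (set 'rV[R]_n)^nat) :
  (forall i, borel (F i)) -> borel (\bigcup_i F i).
Proof. exact: sigma_algebra_bigcup. Qed.

HB.instance Definition _ :=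
  @isMeasurable.Build default_measure_display 'rV[R]_n borel borel0 borelC borelU.

End borel.

Section measurable_rV.
Context (R : realType) (n : nat).

Lemma open_measurable_rV (U : set 'rV[R]_n) : open U -> measurable U.
Proof. exact: sub_sigma_algebra. Qed.

Lemma measurable_coord (i : 'I_n) :
  measurable_fun [set: 'rV[R]_n] (fun v : 'rV[R]_n => v 0 i).
Proof.
have := @measurability _ _ 'rV[R]_n R setT (fun v : 'rV[R]_n => v 0 i)
  _ (measurable_realfun.RGenOpens.measurableE R).
apply.
move=> _ [_ [a [b ->]] <-].
rewrite setTI; apply: open_measurable_rV.
by apply: open_comp; [move=> x _; exact: coord_continuous|exact: interval_open].
Qed.

Let rat_ball (p : 'rV[rat]_n * nat) : set 'rV[R]_n :=
  [set v | forall i, ball (ratr (p.1 0 i) : R) p.2.+1%:R^-1 (v 0 i : R)].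

Lemma open_rV_bigcup (U : set 'rV[R]_n) : open U ->
  U = \bigcup_(p in [set p | rat_ball p `<=` U]) rat_ball p.
Proof.
move=> oU; apply/seteqP; split; last by move=> v [p /= pU pv]; exact: pU.
move=> v Uv; have /nbhs_ballP [e /= e0 veU] := open_nbhs_nbhs (conj oU Uv).
have e20 : 0 < e / 2 by rewrite divr_gt0.
pose k := Num.truncn (e / 2)^-1.
have k1e : k.+1%:R^-1 < e / 2.
  by rewrite invf_plt ?posrE// /k truncnS_gt.
have k0 : 0 < k.+1%:R^-1 :> R by rewrite invr_gt0.
have ratP i : exists q : rat, `|ratr q - v 0 i| < k.+1%:R^-1.
  have /rat_in_itvoo[q] : v 0 i - k.+1%:R^-1 < v 0 i + k.+1%:R^-1.
    by rewrite ltrD2l; apply: (lt_trans _ k0); rewrite oppr_lt0.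
  rewrite in_itv/= => /andP[q1 q2]; exists q.
  by rewrite ltr_distl q1 q2.
have [q qP] := choice ratP.
exists (\row_i q i, k) => /=; last by move=> i /=; rewrite mxE; exact: qP.
move=> w /= qw; apply: veU; split => // i j; rewrite (ord1 i).
have := qw j; rewrite /= mxE => qwj.
rewrite /ball/= (le_lt_trans (ler_distD (ratr (q j)) _ _))//.
rewrite [e in _ < e]splitr ltrD//.
  by rewrite distrC; exact: (lt_trans (qP _) k1e).
exact: (lt_trans qwj k1e).
Qed.

Lemma measurable_fun_rV d (T : measurableType d) (f : T -> 'rV[R]_n) :
  (forall i, measurable_fun setT (fun t => f t 0 i)) -> measurable_fun setT f.
Proof.
move=> mf; have := @measurability _ _ T 'rV[R]_n setT f open erefl; apply.
move=> _ [U oU <-]; rewrite setTI (open_rV_bigcup oU) preimage_bigcup.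
rewrite bigcup_mkcond; apply: countable_bigcupT_measurable => // p.
case: ifP => // _; rewrite (_ : f @^-1` _ =
    \bigcap_(i in [set: 'I_n]) ((fun t => f t 0 i) @^-1`
      ball (ratr (p.1 0 i) : R) (p.2.+1%:R^-1))).
  apply: fin_bigcap_measurable => // i _; rewrite -[X in measurable X]setTI.
  by apply: mf => //; rewrite ball_itv; exact: measurable_itv.
by apply/seteqP; split => [t /= ft i _|t /= ft i]; [exact: ft|exact: (ft i)].
Qed.

End measurable_rV.

Section lebesgue_rV.
Context {R : realType}.
Local Open Scope ereal_scope.

Definition cons_rV n (p : R * 'rV[R]_n) : 'rV[R]_n.+1 :=
  \row_i (if unlift ord0 i is Some j then p.2 0%R j else p.1).

Fixpoint lebesgue_rV (n : nat) : set 'rV[R]_n -> \bar R :=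
  match n with
  | 0 => dirac (0%R : 'rV[R]_0)
  | n.+1 => pushforward (lebesgue_measure \x @lebesgue_rV n) (@cons_rV n)
  end.

Lemma measurable_cons_rV n :
  measurable_fun [set: measurableTypeR R * 'rV[R]_n] (@cons_rV n).
Proof.
apply: measurable_fun_rV => i.
under eq_fun do rewrite mxE.
case: (unlift ord0 i) => [j|]; last exact: measurable_fst.
by apply: (measurableT_comp (measurable_coord j)); exact: measurable_snd.
Qed.

Let lebesgue_rV_sfm n : exists m : {sigma_finite_measure set 'rV[R]_n -> \bar R},
  @lebesgue_rV n = m.
Proof.
elim: n => [|n [m IH]] /=.
  by exists (dirac (0%R : 'rV[R]_0)).
rewrite IH.
pose pm : {measure set (measurableTypeR R * 'rV[R]_n)%type -> \bar R} :=
  lebesgue_measure \x m.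
pose mu : {measure set 'rV[R]_n.+1 -> \bar R} :=
  measure_function_pushforward__canonical__measure_function_Measure pm
    (@measurable_cons_rV n).
have sf : sigma_finite setT mu.
  have /sigma_finiteP[F [UF ndF mF]] := sigma_finiteT (@lebesgue_measure R).
  have /sigma_finiteP[G [UG ndG mG]] := sigma_finiteT m.
  pose tl (v : 'rV[R]_n.+1) : 'rV[R]_n := \row_j v 0%R (lift ord0 j).
  have mtl : measurable_fun setT tl.
    apply: measurable_fun_rV => j; under eq_fun do rewrite mxE.
    exact: measurable_coord.
  exists (fun k => (fun v : 'rV[R]_n.+1 => v 0%R ord0) @^-1` F k `&` tl @^-1` G k).
    apply/seteqP; split => // v _.
    have : [set: R] (v 0%R ord0) by []. rewrite UF => -[i _ Fi].
    have : [set: 'rV[R]_n] (tl v) by []. rewrite UG => -[j _ Gj].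
    exists (maxn i j) => //; split => /=.
      by move: Fi; apply/subsetPset/ndF/leq_maxl.
    by move: Gj; apply/subsetPset/ndG/leq_maxr.
  move=> k; have [mFk Fkoo] := mF k; have [mGk Gkoo] := mG k; split.
    apply: measurableI; rewrite -[X in measurable X]setTI.
      exact: measurable_coord.
    exact: mtl.
  rewrite /mu/= /pushforward (_ : _ @^-1` _ = F k `*` G k); last first.
    apply/funext => -[x v] /=; rewrite /cons_rV mxE unlift_none/=.
    congr (_ /\ G k _).
    by apply/rowP => j; rewrite !mxE liftK.
  by rewrite product_measure1E// lte_mul_pinfty// ge0_fin_numE.
by exists (HB.pack_for {sigma_finite_measure set 'rV[R]_n.+1 -> \bar R}
  (Measure.sort mu) mu (Measure_isSigmaFinite.Build _ _ _ mu sf)).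
Qed.

Let lebesgue_rV0 n : @lebesgue_rV n set0 = 0.
Proof. by have [m ->] := lebesgue_rV_sfm n; exact: measure0. Qed.

Let lebesgue_rV_ge0 n A : 0 <= @lebesgue_rV n A.
Proof. by have [m ->] := lebesgue_rV_sfm n; exact: measure_ge0. Qed.

Let lebesgue_rV_sigma_additive n : semi_sigma_additive (@lebesgue_rV n).
Proof.
by have [m ->] := lebesgue_rV_sfm n; exact: measure_semi_sigma_additive.
Qed.

HB.instance Definition _ n := isMeasure.Build _ _ _ (@lebesgue_rV n)
  (@lebesgue_rV0 n) (@lebesgue_rV_ge0 n) (@lebesgue_rV_sigma_additive n).

Let lebesgue_rV_sigma_finite n : sigma_finite setT (@lebesgue_rV n).
Proof. by have [m ->] := lebesgue_rV_sfm n; exact: sigma_finiteT. Qed.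

HB.instance Definition _ n := Measure_isSigmaFinite.Build _ _ _
  (@lebesgue_rV n) (@lebesgue_rV_sigma_finite n).

Lemma lebesgue_rV_box n (A : 'I_n -> set R) :
  (forall i, measurable (A i)) ->
  lebesgue_rV [set v : 'rV[R]_n | forall i, A i (v 0%R i)] =
  \prod_(i < n) lebesgue_measure (A i).
Proof.
elim: n A => [A _|n IH A mA].
  rewrite big_ord0 /= diracE mem_set//= => -[].
  by [].
have boxE : @cons_rV n @^-1` [set v : 'rV[R]_n.+1 | forall i, A i (v 0%R i)] =
    A ord0 `*` [set v : 'rV[R]_n | forall j, A (lift ord0 j) (v 0%R j)].
  apply/seteqP; split => -[x v] /=; rewrite /cons_rV.
    move=> Av; split; first by have := Av ord0; rewrite mxE unlift_none.
    by move=> j; have := Av (lift ord0 j); rewrite mxE liftK.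
  by move=> [Ax Av] i; rewrite mxE; case: unliftP => [j ->|->//]; exact: Av.
rewrite big_ord_recl -(IH (fun i => A (lift ord0 i)))//.
rewrite [LHS]/= /pushforward boxE [LHS]product_measure1E//; first exact: mA.
rewrite [X in measurable X](_ : _ = \bigcap_(j in [set: 'I_n])
    ((fun v : 'rV[R]_n => v 0%R j) @^-1` A (lift ord0 j))).
  apply: fin_bigcap_measurable => // j _; rewrite -[X in measurable X]setTI.
  by apply: measurable_coord => //; exact: mA.
by apply/seteqP; split => [v /= Av j _|v /= Av j]; [exact: Av|exact: (Av j)].
Qed.


End lebesgue_rV.
Arguments lebesgue_rV R n A : clear implicits.

Section norms.
Context {R : realType} {d : nat}.
Implicit Types (N : 'rV[R]_d -> R) (x : 'rV[R]_d) (r : R).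

(* The library norm on 'rV[R]_d is the sup norm; N stands for an arbitrary
   norm. All norms induce the library topology of 'rV[R]_d. *)
Definition is_norm N : Prop :=
  [/\ forall x y, N (x + y) <= N x + N y,
      forall (a : R) x, N (a *: x) = `|a| * N x
    & forall x, N x = 0 -> x = 0].

Definition norm_ball N x r : set 'rV[R]_d := [set y | N (x - y) <= r].

Definition unit_ball_volume N : \bar R := lebesgue_rV R d (norm_ball N 0 1).

Definition msupport N (nu : set 'rV[R]_d -> \bar R) : set 'rV[R]_d :=
  [set x | forall r, 0 < r -> (0 < nu (norm_ball N x r))%E].

End norms.

Definition is_density {R : realType} d (T : measurableType d)
    (nu : set T -> \bar R) (mu : {measure set T -> \bar R}) (p : T -> R) : Prop :=
  [/\ measurable_fun setT p,
      forall x, 0 <= p x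
    & forall A, measurable A -> (nu A = \int[mu]_(x in A) (p x)%:E)%E].

Section independence.
Context {R : realType} dO (Omega : measurableType dO) (P : probability Omega R).
Context dT (T : measurableType dT).

Definition independent (I : choiceType) (F : I -> set (set Omega)) : Prop :=
  forall (J : {fset I}) (A : I -> set Omega),
    (forall i, i \in J -> F i (A i)) ->
    (P (\bigcap_(i in [set` J]) A i) = \prod_(i <- J) P (A i))%E.

Definition sigma_rv (X : Omega -> T) : set (set Omega) :=
  preimage_set_system setT X measurable.

Definition sigma_rv_seq (X : nat -> Omega -> T) : set (set Omega) :=
  <<s \bigcup_j sigma_rv (X j) >>.

Definition has_law (X : {RV P >-> T}) (mu : probability T R) : Prop :=
  forall A, measurable A -> distribution P X A = mu A.

Definition iid_law (X : nat -> {RV P >-> T}) (mu : probability T R) : Prop :=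
  independent (fun j => sigma_rv (X j)) /\ forall j, has_law (X j) mu.

End independence.

Definition regression {R : realType} {d : nat} dT (Theta : measurableType dT)
    (mu : probability Theta R) (f : 'rV[R]_d * Theta -> R) (x : 'rV[R]_d) : R :=
  fine 'E_mu[fun theta => f (x, theta)].

(* Sequences are indexed from 0: the training set of size m is
   (pts j, ys j) for j < m, and knn_index l is the index of the (l+1)-th
   nearest point. *)
Section nearest_neighbors.
Context {R : realType} {d : nat} (N : 'rV[R]_d -> R).
Variables (pts : nat -> 'rV[R]_d) (ys : nat -> R) (m : nat) (x : 'rV[R]_d).

Definition knn_le : rel nat := fun i j =>
  (N (x - pts i) < N (x - pts j)) ||
  ((N (x - pts i) == N (x - pts j)) && (i <= j)%N).

Definition knn_index (l : nat) : nat := nth 0%N (sort knn_le (iota 0 m)) l.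

Definition knn_estimator (k : nat) : R :=
  k%:R^-1 * \sum_(l < k) ys (knn_index l).

End nearest_neighbors.

(* Main.v *)
Require Import Defs.
From HB Require Import structures.
From mathcomp Require Import all_boot all_order all_algebra.
From mathcomp Require Import finmap.
From mathcomp Require Import all_classical all_reals all_analysis measurable_realfun.
From mathcomp Require Import zify ring lra.

(** The constant may depend on all the data and the moment of
    [p (X) ^ (- 2 / d)] is positive, so it suffices that [m ^ (2 / (d + 2))] times
    the mean square error stays bounded. By independence of the three sources the
    error splits, for frozen design points, into a variance term at most
    [sigma ^ 2 / k] (the residuals are uncorrelated) and a bias term at most [L ^ 2]
    times the mean squared distance to the [k] nearest points. Cutting the sample
    into [k] blocks of size [s = m %/ k], that mean is at most the average over
    blocks of the squared distance to the nearest point of the block. For a fixed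
    [x] the latter has tail [P (N (x - X') > u) ^ s]: the small-ball hypothesis makes
    it exponentially small up to [r_kappa], and the integrability of the minimum of
    [m0] norms makes it polynomially small beyond, so its mean is at most a constant
    times [(1 + N x ^ 2) / (s * p x) ^ (2 / d)]. *)

Set Implicit Arguments.
Unset Strict Implicit.
Unset Printing Implicit Defensive.

Import Order.TTheory GRing.Theory Num.Theory.
Import numFieldNormedType.Exports.

Local Open Scope classical_set_scope.
Local Open Scope ring_scope.

(** * Norms and supports on row vectors *)

(** The law of the distance to the [k]-th neighbor is never studied: block minimizers form a
    competing set of [k] indices, and each block involves only a power of one tail function.

    The bound must be uniform in the query point [x], with exactly the dependence on [s * p x] that
    the moment hypothesis can integrate. The scale [a] defined by [a ^ d = q * s / 2], with [q]
    proportional to [p x], carries this dependence. The tail of the distance is asked to be of order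
    [(a * u) ^ - 4]: in terms of the squared distance this is an inverse square, which is integrable
    at infinity and integrates to a multiple of [a ^ - 2]. The same fourth power explains the
    requirement [8 * m0 <= s]: raising a Markov bound to the fourth power uses up [4 * m0] factors,
    and at least half of the [s] factors must be left for the exponential bound.

    The variance is controlled only on the support of [muX'], and the density only on [U], so the
    integrands of the error are compared almost everywhere. With [k] of order [m ^ (2 / (d + 2))],
    the variance order [1 / k] and the bias order [(k / m) ^ (2 / d)] coincide. *)

Section norm_theory.
Context {R : realType} {d : nat} (N : 'rV[R]_d -> R).
Hypothesis N_norm : is_norm N.

Lemma is_norm0 : N 0 = 0.
Proof. by have [_ NZ _] := N_norm; rewrite -(scale0r 0) NZ normr0 mul0r. Qed.

Lemma is_normN x : N (- x) = N x.
Proof. by have [_ NZ _] := N_norm; rewrite -scaleN1r NZ normrN1 mul1r. Qed.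

Lemma is_norm_ge0 x : 0 <= N x.
Proof.
have [ND _ _] := N_norm; have := ND x (- x).
by rewrite subrr is_norm0 is_normN; lra.
Qed.

Lemma is_norm_dist x y : `|N x - N y| <= N (x - y).
Proof.
have [ND _ _] := N_norm.
have Nsub a b : N a - N b <= N (a - b).
  by rewrite lerBlDr -{1}(subrK b a).
by rewrite ler_norml Nsub andbT lerNl opprB -(is_normN (x - y)) opprB.
Qed.

(** The triangle inequality over the coordinates bounds any norm by the sup norm; this yields
    continuity of [N], hence measurability of all the distances. The summand [1] keeps the constant
    positive even for [d = 0]. *)
Lemma is_norm_le : exists2 K : R, 0 < K & forall x, N x <= K * `|x|.
Proof.
have [ND NZ _] := N_norm.
exists (1 + \sum_(i < d) N (delta_mx 0 i)).
  by rewrite ltr_pwDl// sumr_ge0// => i _; exact: is_norm_ge0.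
move=> x; rewrite mulrDl mul1r [in N x](row_sum_delta x).
apply: (@le_trans _ _ (\sum_(i < d) N (x 0 i *: delta_mx 0 i))).
  elim/big_ind2 : _ => //; first by rewrite is_norm0.
  by move=> a b u v ab uv; exact: le_trans (ND _ _) (lerD ab uv).
rewrite -[leLHS]add0r lerD// mulr_suml ler_sum// => i _.
rewrite NZ mulrC ler_wpM2l ?is_norm_ge0//.
by rewrite [leRHS]mx_normrE; exact: (le_bigmax_cond _ _ (isT : xpredT (0, i))).
Qed.

Lemma lipschitz_is_norm_continuous (g : 'rV[R]_d -> R) (L : R) : 0 <= L ->
  (forall x y, `|g x - g y| <= L * N (x - y)) -> continuous g.
Proof.
move=> L0 gL; have [K K0 NK] := is_norm_le.
move=> x; apply/(@cvgrPdist_lt _ _ _ (nbhs x) (nbhs_filter x)) => e e0.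
have LK0 : 0 < L * K + 1 by rewrite ltr_wpDl// mulr_ge0// ltW.
have xe : \forall y \near x, `|x - y| < e / (L * K + 1).
  by apply/nbhs_normP; exists (e / (L * K + 1)) => /=;
    [rewrite divr_gt0|move=> z].
apply: filterS xe => y xy.
rewrite (le_lt_trans (gL _ _))//.
apply: (@le_lt_trans _ _ ((L * K + 1) * `|x - y|)).
  by rewrite mulrDl mul1r -mulrA ler_wpDr// ler_wpM2l.
by rewrite mulrC -ltr_pdivlMr.
Qed.

Lemma is_norm_continuous : continuous N.
Proof.
apply: (@lipschitz_is_norm_continuous _ 1) => // x y.
by rewrite mul1r is_norm_dist.
Qed.

Lemma continuous_measurable_rV (g : 'rV[R]_d -> R) :
  continuous g -> measurable_fun setT g.
Proof.
move=> gc; have := @measurability _ _ 'rV[R]_d R setT g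
  _ (measurable_realfun.RGenOpens.measurableE R); apply.
move=> _ [_ [a [b ->]] <-]; rewrite setTI; apply: open_measurable_rV.
by apply: open_comp; [move=> x _; exact: gc|exact: interval_open].
Qed.

Lemma measurable_is_norm : measurable_fun setT N.
Proof. by apply: continuous_measurable_rV; exact: is_norm_continuous. Qed.

Lemma measurable_fun_subrV dT (T : measurableType dT) (g h : T -> 'rV[R]_d) :
  measurable_fun setT g -> measurable_fun setT h ->
  measurable_fun setT (fun t => g t - h t).
Proof.
move=> mg mh; apply: measurable_fun_rV => i; under eq_fun do rewrite !mxE.
apply: measurable_funB.
  exact: (measurableT_comp (measurable_coord i) mg).
exact: (measurableT_comp (measurable_coord i) mh).
Qed.

Lemma measurable_is_norm_sub dT (T : measurableType dT) (g h : T -> 'rV[R]_d) :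
  measurable_fun setT g -> measurable_fun setT h ->
  measurable_fun setT (fun t => N (g t - h t)).
Proof.
move=> mg mh; apply: (measurableT_comp measurable_is_norm).
exact: measurable_fun_subrV.
Qed.

Lemma measurable_norm_ball x r : measurable (norm_ball N x r).
Proof.
rewrite -[norm_ball _ _ _]setTI; apply: (measurable_fun_ler _ _) => //.
exact: measurable_is_norm_sub.
Qed.

(** The ball contains the cube of half-side [K^-1], whose volume is the product of its side
    lengths. *)
Lemma unit_ball_volume_gt0 : (0 < unit_ball_volume N)%E.
Proof.
have [K K0 NK] := is_norm_le.
pose A := [set v : 'rV[R]_d | forall i, v 0 i \in `[(- K^-1 : R), K^-1]].
have mA : measurable A.
  rewrite (_ : A = \bigcap_(i in [set: 'I_d])
      ((fun v : 'rV[R]_d => v 0 i) @^-1` [set` `[(- K^-1 : R), K^-1]])).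
    apply: fin_bigcap_measurable => // i _; rewrite -[X in measurable X]setTI.
    exact: measurable_coord.
  by apply/seteqP; split => [v /= Av j _|v /= Av j]; [exact: Av|exact: (Av j)].
apply: (@lt_le_trans _ _ (lebesgue_rV R d A)); last first.
  apply: le_measure; rewrite ?inE//; first exact: measurable_norm_ball.
  move=> v Av; rewrite /norm_ball/= sub0r is_normN (le_trans (NK _))//.
  rewrite -ler_pdivlMl// mulr1 [leLHS]mx_normrE; apply/bigmax_leP; split => /=.
    by rewrite invr_ge0 ltW.
  by move=> [i j] _; rewrite (ord1 i) ler_norml; have := Av j; rewrite in_itv.
rewrite /A (@lebesgue_rV_box R d (fun=> [set` `[(- K^-1 : R), K^-1]]))//.
rewrite lebesgue_measure_itv/= lte_fin gtrN ?invr_gt0// opprK.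
elim/big_ind : _ => // [x y x0 y0|_ _]; first by rewrite mule_gt0.
by rewrite -EFinD lte_fin addr_gt0// invr_gt0.
Qed.

(** A point outside the support has a null ball around it, which contains a rational cube around the
    point. There are countably many such cubes, so the null ones have a null union. [F] enumerates
    them by their codes, with [set0] at the other integers. *)
Lemma msupport_negligible (nu : probability 'rV[R]_d R) :
  nu.-negligible (~` msupport N nu).
Proof.
pose F (n : nat) : set 'rV[R]_d :=
  if (choice.unpickle n : option ('rV[rat]_d * nat)) is Some q then
    let B := [set v : 'rV[R]_d |
      forall i : 'I_d, ball (ratr (q.1 0 i) : R) q.2.+1%:R^-1 (v 0 i)] in
    if `[< nu.-negligible B >] then B else set0
  else set0.
apply: (@negligibleS _ _ _ _ (\bigcup_n F n)); last first.
  apply: negligible_bigcup => n; rewrite /F.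
  case: choice.unpickle => [q /=|]; last exact: negligible_set0.
  by case: ifPn => [/asboolP//|_]; exact: negligible_set0.
move=> x; rewrite /msupport/= -existsNE => -[r] /not_implyP[r0].
move=> /negP; rewrite -leNgt => nu0.
have oU : open [set y | N (x - y) < r].
  rewrite (_ : [set y | N (x - y) < r] =
      (fun y => N (x - y)) @^-1` [set z | z < r])//.
  apply: open_comp; last exact: open_lt.
  move=> y _; apply: (@lipschitz_is_norm_continuous _ 1) => // u v.
  rewrite mul1r (le_trans (is_norm_dist _ _))// -is_normN.
  by rewrite opprB opprB addrC addrA subrK.
have Ux : [set y | N (x - y) < r] x by rewrite /= subrr is_norm0.
move: Ux; rewrite {1}(open_rV_bigcup oU) => -[q /= qU qx].
exists (choice.pickle q) => //; rewrite /F choice.pickleK/=.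
case: ifPn => // /asboolP; apply: contra_notP => _.
apply: (@negligibleS _ _ _ _ (norm_ball N x r)).
  by move=> y /qU/= /ltW.
exists (norm_ball N x r); split => //; first exact: measurable_norm_ball.
by apply/eqP; rewrite eq_le nu0 measure_ge0.
Qed.

End norm_theory.

(** * Minima of i.i.d. variables *)

Section weak_type.
Context d (T : measurableType d) (R : realType) (P : probability T R).

(* Truncating [W] at the levels [A * 2 ^ n] and summing over dyadic shells:
   each shell contributes at most [A * 2 ^ n * 4 ^ - n]. *)
Lemma integral_le_weak_type (W : T -> \bar R) (A : R) : 0 < A ->
  measurable_fun setT W -> (forall t, 0 <= W t)%E ->
  (forall v : R, 0 < v -> (P [set t | v%:E < W t] <= (A ^+ 2 / v ^+ 2)%:E)%E) ->
  (\int[P]_t W t <= (3 * A)%:E)%E.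
Proof.
move=> A0 mW W0 tailW.
pose g n t := mine (W t) (A * 2 ^+ n)%:E.
have mg n : measurable_fun setT (g n) by exact: measurable_mine.
have lev0 n : 0 < A * 2 ^+ n by rewrite mulr_gt0// exprn_gt0.
have g0 n t : (0 <= g n t)%E by rewrite le_min W0 lee_fin ltW.
have g_homo m n t : (m <= n)%N -> (g m t <= g n t)%E.
  move=> mn; rewrite /g le_min !ge_min lexx/=; apply/orP; right.
  by rewrite lee_fin ler_pM2l// ler_weXn2l// ler1n.
(* The truncation at level [0] contributes [A], and passing from level [n] to the next adds at most
   [A * 2 ^ n * 4 ^ - n = A / 2 ^ n]; these increments sum to [A * (2 - 2 / 2 ^ n)]. *)
have intg n : (\int[P]_t g n t <= (A * (3 - 2 / 2 ^+ n))%:E)%E.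
  elim: n => [|n IH].
    apply: (@le_trans _ _ (\int[P]_t (cst A%:E) t)%E).
      apply: ge0_le_integral => //.
      by move=> t _; rewrite /g expr0 mulr1 ge_min lexx orbT.
    by rewrite integral_cst//= probability_setT mule1 lee_fin expr0; lra.
  pose S := [set t | ((A * 2 ^+ n)%:E < W t)%E].
  have mS : measurable S.
    by rewrite -[S]setTI; exact: emeasurable_fun_o_infty.
  pose i1 t : \bar R := (\1_S t : R)%:E.
  have mi : measurable_fun setT i1.
    by apply/measurable_EFinP; exact: measurable_indic.
  apply: (@le_trans _ _ (\int[P]_t (g n t + (A * 2 ^+ n)%:E * i1 t))%E).
    apply: ge0_le_integral => //.
      apply: emeasurable_funD => //; exact: emeasurable_funM.
    move=> t _; rewrite /g /i1 indicE.
    case: (leP (W t) (A * 2 ^+ n)%:E) => Wt.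
      rewrite memNset ?mule0 ?adde0; last by rewrite /S/=; apply/negP; rewrite -leNgt.
      by rewrite ge_min lexx.
    rewrite mem_set// mule1 -EFinD ge_min; apply/orP; right.
    by rewrite lee_fin exprS; lra.
  rewrite ge0_integralD//; last 2 first.
  - by move=> t _; rewrite mule_ge0// lee_fin// ltW.
  - exact: emeasurable_funM.
  rewrite ge0_integralZl//; last 2 first.
  - by move=> t _; rewrite lee_fin.
  - by rewrite lee_fin ltW.
  rewrite /i1 integral_indic// setIT.
  apply: (@le_trans _ _ ((A * (3 - 2 / 2 ^+ n))%:E +
      (A * 2 ^+ n)%:E * (A ^+ 2 / (A * 2 ^+ n) ^+ 2)%:E)%E).
    apply: leeD; first exact: IH.
    by apply: lee_wpmul2l; [rewrite lee_fin ltW|exact: tailW].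
  rewrite -EFinM -EFinD lee_fin [2 ^+ n.+1]exprS.
  have p0 : 0 < 2 ^+ n :> R by rewrite exprn_gt0.
  suff : A * 2 ^+ n * (A ^+ 2 / (A * 2 ^+ n) ^+ 2) = A * (2 ^+ n)^-1.
    move=> ->; move: p0; move: (2 ^+ n) => q q0.
    by rewrite le_eqVlt; apply/orP; left; apply/eqP; field; rewrite gt_eqF.
  by move: p0; move: (2 ^+ n) => q q0; field; rewrite !gt_eqF.
have gW t : limn (g^~ t) = W t.
  apply/cvg_lim => //; have := W0 t; rewrite /g; case: (W t) => [r r0| _|//].
    apply: cvg_near_cst; near=> n; rewrite min_l// lee_fin.
    rewrite -ler_pdivrMl//.
    apply: (@le_trans _ _ n%:R).
      by near: n; exact: nbhs_infty_ger.
    by rewrite -natrX ler_nat ltnW// ltn_expl.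
  apply/cvgeyPge => B; near=> n; rewrite min_r ?leey// lee_fin.
  rewrite -ler_pdivrMl//.
  apply: (@le_trans _ _ n%:R).
    by near: n; exact: nbhs_infty_ger.
  by rewrite -natrX ler_nat ltnW// ltn_expl.
rewrite -(eq_integral _ _ (fun t _ => gW t)) monotone_convergence//; last first.
  by move=> t _ m n mn; exact: g_homo.
apply: lime_le; last first.
  apply: nearW => n; rewrite (le_trans (intg n))// lee_fin.
  by rewrite [leRHS]mulrC ler_wpM2l ?(ltW A0)// gerBl divr_ge0// exprn_ge0.
apply: ereal_nondecreasing_is_cvgn => m n mn; apply: ge0_le_integral => // t _.
exact: g_homo.
Unshelve. all: by end_near. Qed.

End weak_type.

Section iid_min.
Context d (T : measurableType d) dO (Omega : measurableType dO) (R : realType).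
Context (P : probability Omega R) (X : nat -> {RV P >-> T}) (mu : probability T R).

Lemma bigmine_gt (s : seq nat) (F : nat -> \bar R) (v : R) :
  (v%:E < \big[mine/+oo]_(j <- s) F j)%E = all (fun j => v%:E < F j)%E s.
Proof.
elim: s => [|a s IH]; first by rewrite big_nil ltry.
by rewrite big_cons lt_min IH.
Qed.

Lemma measurable_bigmine (s : seq nat) (F : nat -> Omega -> \bar R) :
  (forall j, measurable_fun setT (F j)) ->
  measurable_fun setT (fun w => \big[mine/+oo%E]_(j <- s) F j w).
Proof.
move=> mF; elim: s => [|a s IH].
  by under eq_fun do rewrite big_nil; exact: measurable_cst.
by under eq_fun do rewrite big_cons; exact: measurable_mine.
Qed.

(** The minimum exceeds [v] exactly when every term does, and independence turns this into a power.
    [uniq s] ensures that the finite set of indices has [size s] elements. *)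
Lemma iid_bigmine_tail (h : T -> R) (s : seq nat) (v : R) :
  iid_law X mu -> measurable_fun setT h -> uniq s ->
  P [set w | (v%:E < \big[mine/+oo]_(j <- s) (h (X j w))%:E)%E] =
  (fine (mu [set x | v < h x]) ^+ size s)%:E.
Proof.
move=> [indX lawX] mh us.
have mhv : measurable [set x | v < h x].
  by rewrite -[X in measurable X]setTI; exact: measurable_fun_ltr.
rewrite (_ : [set w | _] =
    \bigcap_(j in [set` [fset j in s]%fset]) (X j @^-1` [set x | v < h x])).
  rewrite indX; last first.
    move=> j _; exists [set x | v < h x] => //.
    by rewrite setTI.
  rewrite (eq_bigr (fun=> (fine (mu [set x | v < h x]))%:E)); last first.
    move=> j _; rewrite fineK ?fin_num_measure// -(lawX j)//.
  rewrite prodEFin big_const_seq count_predT iter_mulr_1 card_fseq.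
  by rewrite undup_id.
apply/seteqP; split => w /=.
  rewrite bigmine_gt => /allP hs j /=; rewrite !inE => js.
  by have := hs _ js; rewrite lte_fin.
move=> hs; rewrite bigmine_gt; apply/allP => j js; rewrite lte_fin.
by apply: (hs j); rewrite /= !inE.
Qed.

End iid_min.

(** * Distance to the nearest of several i.i.d. points *)

Section tail_estimates.
Context {R : realType}.

(** Here [256 = 4 ^ 4]. For [z >= 1], [z ^ d >= z], and [expR z] is the fourth power of
    [expR (z / 4)], which is at least [z / 4]. For [z <= 1], the left side is at most [1] and the
    right side at least [256]. *)
Lemma expR_exprn_le (d : nat) (z : R) : (0 < d)%N -> 0 < z ->
  expR (- z ^+ d) <= 256 / z ^+ 4.
Proof.
move=> d0 z0; have z40 : 0 < z ^+ 4 by rewrite exprn_gt0.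
have [z1|/ltW z1] := leP z 1.
  rewrite (@le_trans _ _ 1)//.
    by rewrite -expR0 ler_expR oppr_le0 exprn_ge0// ltW.
  rewrite ler_pdivlMr// mul1r (@le_trans _ _ 1)//; last by lra.
  by rewrite exprn_ile1// ltW.
rewrite (@le_trans _ _ (expR (- z)))//.
  by rewrite ler_expR lerN2 ler_eXnr.
rewrite expRN -[X in expR X](@divfK _ 4)// expRM_natr.
rewrite -[leRHS]invrK invf_div lef_pV2 ?posrE ?exprn_gt0 ?expR_gt0 ?divr_gt0//.
rewrite (_ : z ^+ 4 / 256 = (z / 4) ^+ 4); last by field.
rewrite lerXn2r ?nnegrE ?expR_ge0 ?divr_ge0 ?(ltW z0)//.
by rewrite (le_trans _ (expR_ge1Dx _))// lerDr.
Qed.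

(* Up to [r0] the exponential bound alone gives the decay in [u]. Beyond [r0],
   at least half of the [s] factors are frozen at [r0], which gives the decay in
   [a], and [4 * m0] of them give the decay in [u]. *)
Lemma tail_power_le (H : R -> R) (d m0 s : nat) (q a r0 Q u : R) :
  (0 < d)%N -> 0 < a -> 0 < r0 -> 0 <= Q -> 0 < u ->
  (8 * m0 <= s)%N -> a ^+ d = q * s%:R / 2 ->
  (forall v, 0 <= H v <= 1) -> {homo H : v w / v <= w >-> w <= v} ->
  (forall v, 0 <= v <= r0 -> H v <= expR (- (q * v ^+ d))) ->
  (forall v, 0 < v -> H v ^+ m0 <= Q / v) ->
  H u ^+ s <= 256 * (1 + Q ^+ 4 / r0 ^+ 4) / (a * u) ^+ 4.
Proof.
move=> d0 a0 r00 Q0 u0 ms ad H01 Hhomo Hexp Hpow.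
have q0 : 0 <= q.
  case: s ad {ms} => [|s] ad; last first.
    have : 0 < q * s.+1%:R / 2 by rewrite -ad exprn_gt0.
    by rewrite -mulrA pmulr_lgt0 ?divr_gt0// => /ltW.
  by move: (exprn_gt0 d a0); rewrite ad mulr0 mul0r ltxx.
(* Half of the factors are enough: since [a ^ d = q * s / 2], the exponent [q * n * v ^ d] is at
   least [(a * v) ^ d]. *)
have Hexps v n : 0 < v <= r0 -> (s <= n.*2)%N ->
    H v ^+ n <= 256 / (a * v) ^+ 4.
  move=> /andP[v0 vr] sn.
  apply: (@le_trans _ _ (expR (- (q * v ^+ d)) ^+ n)).
    rewrite lerXn2r ?nnegrE ?expR_ge0//; first by case/andP: (H01 v).
    by rewrite Hexp// (ltW v0).
  rewrite (le_trans _ (expR_exprn_le d0 _)) ?mulr_gt0//.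
  rewrite -expRM_natr ler_expR mulNr lerN2 exprMn ad.
  have -> : q * s%:R / 2 * v ^+ d = q * (v ^+ d * (s%:R / 2)) by field.
  rewrite -mulrA ler_wpM2l// ler_wpM2l ?exprn_ge0 ?(ltW v0)//.
  by rewrite ler_pdivrMr// -natrM ler_nat muln2.
have au0 : 0 < (a * u) ^+ 4 by rewrite exprn_gt0// mulr_gt0.
have r40 : 0 < r0 ^+ 4 by rewrite exprn_gt0.
have [ur|/ltW ru] := leP u r0.
  rewrite (le_trans (Hexps u s _ _)) ?u0//; first by rewrite -addnn leq_addr.
  rewrite ler_wpM2r ?invr_ge0 ?(ltW au0)//.
  by rewrite ler_peMr// lerDl divr_ge0 ?exprn_ge0// ltW.
rewrite -(@subnK (4 * m0) s); last by rewrite (leq_trans _ ms)// leq_mul2r orbT.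
rewrite exprD.
apply: (@le_trans _ _ (256 / (a * r0) ^+ 4 * (Q / u) ^+ 4)).
  rewrite ler_pM ?exprn_ge0//; try by case/andP: (H01 u).
    rewrite (@le_trans _ _ (H r0 ^+ (s - 4 * m0)))//.
      rewrite lerXn2r ?nnegrE//; last exact: Hhomo.
        by case/andP: (H01 u).
      by case/andP: (H01 r0).
    apply: Hexps; first by rewrite r00 lexx.
    rewrite -addnn -leq_subLR.
    by move: ms; lia.
  rewrite mulnC exprM lerXn2r ?nnegrE ?exprn_ge0 ?divr_ge0 ?(ltW u0)//.
    by case/andP: (H01 u).
  exact: Hpow.
rewrite [leLHS](_ : _ = 256 * (Q ^+ 4 / r0 ^+ 4) / (a * u) ^+ 4).
  by rewrite ler_wpM2r ?invr_ge0 ?(ltW au0)// ler_pM2l// lerDr.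
by field; rewrite !gt_eqF.
Qed.

End tail_estimates.

Section nearest_distance.
Context {R : realType} {d : nat} (N : 'rV[R]_d -> R).
Hypotheses (d_gt0 : (0 < d)%N) (N_norm : is_norm N).
Context dO (Omega : measurableType dO) (P : probability Omega R).
Context (X : nat -> {RV P >-> 'rV[R]_d}) (mu : probability 'rV[R]_d R).
Hypothesis X_iid : iid_law X mu.
Variables (m0 : nat).
Hypothesis m0_gt0 : (0 < m0)%N.
Hypothesis min_integrable :
  (\int[P]_w (\big[mine/+oo]_(j < m0) (N (X j w))%:E) < +oo)%E.

Let H x u : R := fine (mu [set y | u < N (x - y)]).

Let mH x u : measurable [set y | u < N (x - y)].
Proof.
rewrite -[X in measurable X]setTI; apply: measurable_fun_ltr => //.
exact: measurable_is_norm_sub.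
Qed.

Let HE x u : (H x u)%:E = mu [set y | u < N (x - y)].
Proof. by rewrite /H fineK// fin_num_measure. Qed.

Let H01 x u : 0 <= H x u <= 1.
Proof. by rewrite -!lee_fin HE measure_ge0 probability_le1. Qed.

Let H_homo x : {homo H x : v w / v <= w >-> w <= v}.
Proof.
move=> v w vw; rewrite -lee_fin !HE le_measure ?inE//.
by move=> y /=; exact: le_lt_trans.
Qed.

(** [H 0 u ^+ m0] is the probability that the minimum of the [m0] norms exceeds [u]; Markov's
    inequality bounds it by [M / u], with [M] the mean of this minimum. To move the center to [x]:
    if [t >= 2 * N x], then [N (x - y) > t] forces [N y > t / 2]; otherwise the right side is at
    least [1]. *)
Lemma norm_tail_le : exists2 M : R, 0 <= M &
  forall x t, 0 < t -> H x t ^+ m0 <= 2 * (M + N x) / t.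
Proof.
have [M M0 MP] : exists2 M : R, 0 <= M & forall u, 0 < u -> H 0 u ^+ m0 <= M / u.
  pose W w := (\big[mine/+oo]_(j <- iota 0 m0) (N (X j w))%:E)%E.
  have WE : (fun w => \big[mine/+oo]_(j < m0) (N (X j w))%:E)%E = W.
    apply/funext => w.
    by rewrite -(big_mkord xpredT (fun j => (N (X j w))%:E)) /index_iota subn0.
  have mN : measurable_fun setT N by exact: measurable_is_norm.
  have mW : measurable_fun setT W.
    apply: measurable_bigmine => j; apply/measurable_EFinP.
    exact: measurableT_comp.
  have W0 w : (0 <= W w)%E.
    rewrite /W; elim: (iota _ _) => [|j s IH]; first by rewrite big_nil leey.
    by rewrite big_cons le_min IH lee_fin is_norm_ge0.
  have intW0 : (0 <= \int[P]_w W w)%E by exact: integral_ge0.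
  have intWE : (\int[P]_w W w)%E = (fine (\int[P]_w W w))%:E.
    by rewrite fineK// ge0_fin_numE// -WE.
  exists (fine (\int[P]_w W w)); first exact: fine_ge0.
  move=> u u0; rewrite ler_pdivlMr// -lee_fin -intWE mulrC.
  have -> : (u * H 0 u ^+ m0)%:E = (u%:E * P [set w | u%:E < W w])%E.
    rewrite (iid_bigmine_tail _ X_iid mN (iota_uniq _ _)) size_iota EFinM.
    congr (_ * (fine (mu _) ^+ _)%:E)%E; apply/seteqP; split => y /=.
      by rewrite sub0r is_normN.
    by rewrite sub0r is_normN.
  have := le_integral_abse P measurableT mW u0; rewrite setTI.
  under [in X in (_ <= X)%E]eq_integral do rewrite gee0_abs//.
  apply: le_trans; apply: lee_wpmul2l; first by rewrite lee_fin ltW.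
  have mle : measurable [set x | (u%:E <= `|W x|)%E].
    rewrite -[X in measurable X]setTI; apply: emeasurable_fun_c_infty => //.
    exact: measurableT_comp.
  have mlt : measurable [set x | (u%:E < W x)%E].
    by rewrite -[X in measurable X]setTI; exact: emeasurable_fun_o_infty.
  rewrite le_measure ?inE// => w /= /ltW.
  by rewrite gee0_abs.
exists M => // x t t0.
have Nx0 : 0 <= N x by exact: is_norm_ge0.
have [t2|t2] := ltP t (2 * N x).
  rewrite (@le_trans _ _ 1)// ?exprn_ile1//; try by case/andP: (H01 x t).
  by rewrite ler_pdivlMr// mul1r; lra.
apply: (@le_trans _ _ (H 0 (t / 2) ^+ m0)).
  have /andP[? ?] := H01 x t; have /andP[? ?] := H01 0 (t / 2).
  rewrite lerXn2r ?nnegrE//.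
  rewrite -lee_fin !HE le_measure ?inE// => y /=.
  rewrite sub0r is_normN// => ty.
  have [ND _ _] := N_norm; have := ND x (- y); rewrite is_normN// => ?.
  by lra.
rewrite (le_trans (MP _ _)) ?divr_gt0// invf_div mulrA.
by rewrite ler_wpM2r ?invr_ge0 ?(ltW t0)//; lra.
Qed.

(** With [v = u ^ 2], the fourth-power decay of the tail of the distance becomes the inverse square
    required by the weak-type bound. The growth in [x] of the tail constant [Q] is the source of the
    factor [1 + N x ^+ 2]. *)
Lemma min_sqr_dist_le (r0 : R) : 0 < r0 ->
  exists2 K : R, 0 <= K & forall x (q : R) (s : seq nat),
    0 < q -> uniq s -> (8 * m0 <= size s)%N ->
    (forall r, 0 <= r <= r0 -> ((q * r ^+ d)%:E <= mu (norm_ball N x r))%E) ->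
    (\int[P]_w (\big[mine/+oo]_(j <- s) (N (x - X j w) ^+ 2)%:E) <=
     (K * (1 + N x ^+ 2) / (q * (size s)%:R) `^ (2 / d%:R))%:E)%E.
Proof.
move=> r00; have [M M0 MP] := norm_tail_le.
(* [K1] is such that [1 + Q ^ 2 / r0 ^ 2 <= K1 * (1 + N x ^ 2)], by
   [Q ^ 2 <= 8 * M ^ 2 + 8 * N x ^ 2]. In the witness below, [3] comes from the weak-type bound,
   [16] is the square root of [256], and the power of [2] undoes the halving in [b]. *)
pose K1 := 1 + 8 * M ^+ 2 / r0 ^+ 2 + 8 / r0 ^+ 2.
have r20 : 0 < r0 ^+ 2 by rewrite exprn_gt0.
have K10 : 0 < K1.
  by rewrite addr_gt0 ?divr_gt0// ltr_wpDr// divr_ge0 ?mulr_ge0 ?exprn_ge0// ltW.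
exists (3 * 16 * K1 * 2 `^ (2 / d%:R)).
  by rewrite !mulr_ge0// ?powR_ge0// ltW.
move=> x q s q0 us ms ballx.
have s0 : (0 < size s)%N by rewrite (leq_trans _ ms)// muln_gt0.
have dn0 : d%:R != 0 :> R by rewrite pnatr_eq0 -lt0n.
pose b : R := q * (size s)%:R / 2.
have b0 : 0 < b by rewrite !mulr_gt0// ltr0n.
pose a : R := b `^ d%:R^-1.
have a0 : 0 < a by rewrite powR_gt0.
have ad : a ^+ d = b by rewrite -powR_mulrn ?(ltW a0)// /a -powRrM mulVf// powRr1// ltW.
have a2 : a ^+ 2 = (q * (size s)%:R) `^ (2 / d%:R) / 2 `^ (2 / d%:R).
  rewrite -powR_mulrn ?(ltW a0)// /a -powRrM mulrC /b powRM ?invr_ge0//; last first.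
    by rewrite mulr_ge0// ltW.
  by rewrite -(@powR_inv1 _ 2)// -powRrM mulN1r powRN.
pose Q := 2 * (M + N x).
have Nx0 : 0 <= N x by exact: is_norm_ge0.
have Q0 : 0 <= Q by rewrite mulr_ge0// addr_ge0.
pose A := 16 * (1 + Q ^+ 2 / r0 ^+ 2) / a ^+ 2.
have A0 : 0 < A.
  rewrite divr_gt0 ?exprn_gt0// mulr_gt0// ltr_pwDl// divr_ge0 ?exprn_ge0//.
  exact: ltW.
have mh : measurable_fun setT (fun y : 'rV[R]_d => N (x - y) ^+ 2).
  by apply: measurable_funX; exact: measurable_is_norm_sub.
apply: (@le_trans _ _ (3 * A)%:E).
  apply: integral_le_weak_type => //.
  - apply: measurable_bigmine => j; apply/measurable_EFinP.
    by have := measurableT_comp mh (measurable_funPT (X j)).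
  - move=> w; elim: s {us ms ballx s0 b b0 a a0 ad a2 A A0} => [|j s IH].
      by rewrite big_nil leey.
    by rewrite big_cons le_min IH lee_fin exprn_ge0// is_norm_ge0.
  move=> v v0; pose u := Num.sqrt v.
  have u0 : 0 < u by rewrite sqrtr_gt0.
  have u2 : u ^+ 2 = v by rewrite sqr_sqrtr// ltW.
  rewrite (iid_bigmine_tail _ X_iid mh us) lee_fin.
  have -> : [set y | v < N (x - y) ^+ 2] = [set y | u < N (x - y)].
    apply/seteqP; split => y /=;
      by rewrite -u2 ltr_pXn2r// ?nnegrE ?is_norm_ge0 ?(ltW u0).
  apply: le_trans
    (@tail_power_le _ (H x) d m0 (size s) q a r0 Q u _ _ _ _ _ _ _ _ _ _ _) _ => //.
  (* The complement of a small ball has mass at most [1 - q * w ^ d <= expR (- (q * w ^ d))]. *)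
  - move=> w wr; rewrite -lee_fin HE.
    have -> : [set y | w < N (x - y)] = ~` norm_ball N x w.
      by apply/seteqP; split => y; rewrite /norm_ball/= ltNge; [move/negP|move/negP].
    rewrite probability_setC; last exact: measurable_norm_ball.
    apply: (@le_trans _ _ (1 - (q * w ^+ d)%:E)%E).
      by rewrite leeB// ballx.
    by rewrite -EFinB lee_fin expR_ge1Dx.
  - by move=> w w0; exact: MP.
  rewrite /A (exprMn _ a u) -u2.
  have e : 1 + Q ^+ 4 / r0 ^+ 4 <= (1 + Q ^+ 2 / r0 ^+ 2) ^+ 2.
    set t := Q ^+ 2 / r0 ^+ 2; have t0 : 0 <= t by rewrite divr_ge0 ?exprn_ge0// ltW.
    have -> : Q ^+ 4 / r0 ^+ 4 = t ^+ 2 by rewrite /t; field; rewrite gt_eqF.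
    by rewrite sqrrD; lra.
  rewrite [leRHS](_ : _ = 256 * (1 + Q ^+ 2 / r0 ^+ 2) ^+ 2 / (a ^+ 4 * u ^+ 4)).
    by rewrite ler_wpM2r ?invr_ge0 ?mulr_ge0 ?exprn_ge0 ?(ltW a0) ?(ltW u0)// ler_pM2l.
  by field; rewrite !gt_eqF.
rewrite lee_fin.
have e : 1 + Q ^+ 2 / r0 ^+ 2 <= K1 * (1 + N x ^+ 2).
  have Q2 : Q ^+ 2 <= 8 * M ^+ 2 + 8 * N x ^+ 2.
    by rewrite /Q; have := sqr_ge0 (M - N x); nra.
  apply: (@le_trans _ _ (1 + (8 * M ^+ 2 + 8 * N x ^+ 2) / r0 ^+ 2)).
    by rewrite lerD2l ler_wpM2r// invr_ge0 ltW.
  rewrite /K1; have := exprn_ge0 2 M0; have := exprn_ge0 2 Nx0.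
  have : 0 < (r0 ^+ 2)^-1 by rewrite invr_gt0.
  move: (r0 ^+ 2)^-1 (M ^+ 2) (N x ^+ 2) => r' m' n' ? ? ?.
  have ? : 0 <= n' * r' by rewrite mulr_ge0// ltW.
  have ? : 0 <= m' * r' by rewrite mulr_ge0// ltW.
  have ? : 0 <= n' * (m' * r') by rewrite mulr_ge0.
  have ? : 0 <= n' * (n' * r') by rewrite mulr_ge0.
  nra.
rewrite /A a2.
set B := _ `^ _; set B2 := 2 `^ _.
have B20 : 0 < B2 by rewrite powR_gt0.
have B0 : 0 < B by rewrite powR_gt0// mulr_gt0// ltr0n.
rewrite (_ : _ * _ = 3 * 16 * (1 + Q ^+ 2 / r0 ^+ 2) * B2 / B); last first.
  by field; rewrite !gt_eqF.
rewrite ler_wpM2r ?invr_ge0 ?(ltW B0)//.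
by rewrite [leRHS]mulrAC ler_wpM2r ?(ltW B20)// -[leRHS]mulrA ler_pM2l.
Qed.

End nearest_distance.

(** * Sums over nearest neighbors *)

Section initial_segment_sum.
Variables (R : realDomainType) (I : eqType) (g : I -> R).

(* With [tau] separating the values on [A] from those on [B], the sum of
   [min (g - tau) 0] over [A ++ B] is carried by [A]. *)
Lemma sum_initial_segment_le (A B J : seq I) :
  (forall i, 0 <= g i) -> uniq (A ++ B) -> uniq J -> {subset J <= A ++ B} ->
  size J = size A -> {in A & B, forall i j, g i <= g j} ->
  \sum_(i <- A) g i <= \sum_(i <- J) g i.
Proof.
move=> g0 uAB uJ JAB sJA gAB.
pose tau := \big[Num.max/0]_(i <- A) g i.
have tauA i : i \in A -> g i <= tau by move=> iA; exact: le_bigmax_seq.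
have tauB j : j \in B -> tau <= g j.
  move=> jB; rewrite /tau big_seq; apply: bigmax_le => // i iA; exact: gAB.
pose n i := Num.min (g i - tau) 0.
have subtau s : \sum_(i <- s) g i = \sum_(i <- s) (g i - tau) + tau *+ size s.
  by rewrite sumrB big_const_seq count_predT iter_addr_0 subrK.
rewrite !subtau sJA lerD2r.
have -> : \sum_(i <- A) (g i - tau) = \sum_(i <- A ++ B) n i.
  rewrite big_cat/= [X in _ + X]big1_seq ?addr0.
    by apply: eq_big_seq => i iA; rewrite /n min_l// subr_le0 tauA.
  by move=> i /andP[_ iB]; rewrite /n min_r// subr_ge0 tauB.
(* Since [n] is nonpositive, restricting the sum over [A ++ B] to the members of [J] can only
   increase it. *)
have /permPl pAB := perm_filterC (mem J) (A ++ B).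
rewrite -(perm_big _ pAB)/= big_cat/=.
have pJ : perm_eq [seq i <- A ++ B | i \in J] J.
  apply: uniq_perm; rewrite ?filter_uniq// => i.
  by rewrite mem_filter /=; case: (boolP (i \in J)) => //= /JAB.
rewrite (perm_big _ pJ)/= -[leRHS]addr0 lerD//.
  by apply: ler_sum => i _; rewrite /n ge_min lexx.
by apply: sumr_le0 => i _; rewrite /n ge_min lexx orbT.
Qed.

End initial_segment_sum.

Section nearest.
Context {R : realType} {d : nat} (N : 'rV[R]_d -> R).
Variables (pts : nat -> 'rV[R]_d) (m : nat) (x : 'rV[R]_d).

Definition nearest (k : nat) : seq nat :=
  take k (sort (knn_le N pts x) (iota 0 m)).

Lemma nearest_uniq k : uniq (nearest k).
Proof. by rewrite take_uniq// sort_uniq iota_uniq. Qed.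

Lemma size_nearest k : (k <= m)%N -> size (nearest k) = k.
Proof. by move=> km; rewrite size_takel// size_sort size_iota. Qed.

Lemma sum_knn_index (V : nmodType) (y : nat -> V) k : (k <= m)%N ->
  \sum_(l < k) y (knn_index N pts m x l) = \sum_(j <- nearest k) y j.
Proof.
move=> km; rewrite [RHS](big_nth 0%N) size_nearest// big_mkord.
by apply: eq_bigr => l _; rewrite /nearest nth_take.
Qed.

Lemma knn_le_total : total (knn_le N pts x).
Proof.
move=> i j; rewrite /knn_le; case: ltgtP => //= _; exact: leq_total.
Qed.

Lemma knn_le_trans : transitive (knn_le N pts x).
Proof.
move=> j i l; rewrite /knn_le => /orP[ij|/andP[/eqP -> ij]].
  move=> /orP[jl|/andP[/eqP <- _]]; last by rewrite ij.
  by rewrite (lt_trans ij jl).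
move=> /orP[->//|/andP[-> jl]]/=.
by rewrite (leq_trans ij jl) orbT.
Qed.

Lemma knn_le_dist i j : knn_le N pts x i j -> N (x - pts i) <= N (x - pts j).
Proof. by move=> /orP[/ltW//|/andP[/eqP ->]]. Qed.

Lemma sum_nearest_le k (J : seq nat) : (forall v, 0 <= N v) ->
  (k <= m)%N -> uniq J ->
  {subset J <= iota 0 m} -> size J = k ->
  \sum_(j <- nearest k) N (x - pts j) ^+ 2 <= \sum_(j <- J) N (x - pts j) ^+ 2.
Proof.
move=> N0 km uJ JI sJ.
apply: (@sum_initial_segment_le _ _ (fun j => N (x - pts j) ^+ 2) _
  (drop k (sort (knn_le N pts x) (iota 0 m)))) => //.
- by move=> i; rewrite exprn_ge0.
- by rewrite cat_take_drop sort_uniq iota_uniq.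
- by move=> j /JI; rewrite cat_take_drop mem_sort.
- by rewrite size_nearest.
move=> i j iA jB; rewrite lerXn2r ?nnegrE//; apply: knn_le_dist.
have := sort_sorted knn_le_total (iota 0 m).
rewrite -{1}(cat_take_drop k (sort _ _)) sorted_pairwise; last exact: knn_le_trans.
by rewrite pairwise_cat => /andP[/allrelP + _]; apply.
Qed.

(* Cutting the indices into [k] blocks of size [s] and picking a closest point
   in each block gives [k] distinct indices. *)
Lemma sum_nearest_le_blocks k s : (forall v, 0 <= N v) -> (0 < s)%N ->
  (k * s <= m)%N ->
  ((\sum_(j <- nearest k) N (x - pts j) ^+ 2)%:E <=
   \sum_(b < k) \big[mine/+oo]_(j <- iota (b * s) s) (N (x - pts j) ^+ 2)%:E)%E.
Proof.
move=> N0 s0 ksm.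
have km : (k <= m)%N by rewrite (leq_trans _ ksm)// leq_pmulr.
have bP (b : nat) : exists j, (j \in iota (b * s) s) /\
    (\big[mine/+oo]_(j <- iota (b * s) s) (N (x - pts j) ^+ 2)%:E =
     (N (x - pts j) ^+ 2)%:E)%E.
  elim: (iota _ _) (size_iota (b * s) s) => [|a r IH _].
    by move=> /esym/eqP; rewrite eqn0Ngt s0.
  rewrite big_cons; case: r IH => [|a' r] IH.
    by exists a; rewrite mem_head big_nil; split => //; rewrite min_l// leey.
  have {IH} [j [jr ->]] : exists j, (j \in a' :: r) /\
      (\big[mine/+oo]_(j <- a' :: r) (N (x - pts j) ^+ 2)%:E =
      (N (x - pts j) ^+ 2)%:E)%E.
    elim: r a' {IH} => [|a2 r IH] a1.
      by exists a1; rewrite mem_head big_cons big_nil min_l// leey.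
    have [j [jr e]] := IH a2; rewrite big_cons e.
    case: (leP (N (x - pts a1) ^+ 2)%:E (N (x - pts j) ^+ 2)%:E) => _.
      by exists a1; rewrite mem_head.
    by exists j; rewrite inE jr orbT.
  case: (leP (N (x - pts a) ^+ 2)%:E (N (x - pts j) ^+ 2)%:E) => _.
    by exists a; rewrite mem_head.
  by exists j; rewrite inE jr orbT.
have [c cP] := choice bP.
have crange b : (b * s <= c b < b * s + s)%N.
  by have [+ _] := cP b; rewrite mem_iota.
(* The chosen index lies in its own block, so division by [s] recovers the block: the choices are
   pairwise distinct. *)
have cdiv b : (c b %/ s)%N = b.
  have /andP[bc cb] := crange b.
  rewrite -(subnKC bc) divnMDl// divn_small ?addn0//.
  by rewrite ltn_subLR.
rewrite (eq_bigr (fun b : 'I_k => (N (x - pts (c b)) ^+ 2)%:E)); last first.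
  by move=> b _; have [_ ->] := cP b.
rewrite sumEFin lee_fin -(big_mkord xpredT (fun b => N (x - pts (c b)) ^+ 2)).
rewrite -(big_map c xpredT (fun j => N (x - pts j) ^+ 2)).
apply: sum_nearest_le => //.
- rewrite map_inj_in_uniq ?iota_uniq// => a b _ _ e.
  by rewrite -(cdiv a) -(cdiv b) e.
- move=> j /mapP[b]; rewrite mem_index_iota => /= bk ->.
  rewrite mem_iota/= add0n; have /andP[_ cb] := crange b.
  by rewrite (leq_trans cb)// (leq_trans _ ksm)// addnC -mulSn leq_mul2r bk orbT.
- by rewrite size_map size_iota subn0.
Qed.

End nearest.

Lemma knn_estimatorE {R : realType} {d : nat} (N : 'rV[R]_d -> R)
    (pts : nat -> 'rV[R]_d) (ys : nat -> R) (m : nat) (x : 'rV[R]_d) (k : nat) :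
  (k <= m)%N ->
  knn_estimator N pts ys m x k =
  k%:R^-1 * \sum_(j <- nearest N pts m x k) ys j.
Proof. by move=> km; rewrite /knn_estimator sum_knn_index. Qed.

(** * Measurability of the estimator *)

Section measurable_knn.
Context {R : realType} {d : nat} (N : 'rV[R]_d -> R).
Hypothesis N_norm : is_norm N.
Context dS (S : measurableType dS).
Variables (pts : S -> nat -> 'rV[R]_d) (ys : S -> nat -> R) (x : S -> 'rV[R]_d).
Hypothesis mpts : forall j, measurable_fun setT (fun s => pts s j).
Hypothesis mys : forall j, measurable_fun setT (fun s => ys s j).
Hypothesis mx : measurable_fun setT x.

Lemma measurable_knn_le i j :
  measurable_fun setT (fun s => knn_le N (pts s) (x s) i j).
Proof.
have md l : measurable_fun setT (fun s => N (x s - pts s l)).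
  exact: measurable_is_norm_sub.
apply: measurable_or; first exact: measurable_fun_ltr.
by apply: measurable_and; [exact: measurable_fun_eqr|exact: measurable_cst].
Qed.

(* The estimator depends on the distances only through the finite table of
   their comparisons, hence is a finite sum over such tables. *)
Lemma measurable_knn_estimator m k :
  measurable_fun setT (fun s => knn_estimator N (pts s) (ys s) m (x s) k).
Proof.
pose tbl s : {ffun 'I_m * 'I_m -> bool} :=
  [ffun ij : 'I_m * 'I_m => knn_le N (pts s) (x s) ij.1 ij.2].
pose idx (c : {ffun 'I_m * 'I_m -> bool}) (l : nat) : nat :=
  nth 0%N [seq val i | i <- sort (fun i j => c (i, j)) (enum 'I_m)] l.
have idxE s l : knn_index N (pts s) m (x s) l = idx (tbl s) l.
  rewrite /knn_index /idx -val_enum_ord sort_map; congr (nth _ (map _ (sort _ _))).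
  by apply/funext => i; apply/funext => j; rewrite ffunE.
have mtbl c : measurable [set s | tbl s = c].
  rewrite (_ : [set s | _] = \bigcap_(ij in [set: 'I_m * 'I_m])
      (fun s => knn_le N (pts s) (x s) ij.1 ij.2) @^-1` [set c ij]).
    apply: fin_bigcap_measurable; first exact: finite_finset.
    move=> ij _; rewrite -[X in measurable X]setTI.
    exact: measurable_knn_le.
  apply/seteqP; split => s /=; first by move=> <- ij _ /=; rewrite ffunE.
  by move=> h; apply/ffunP => ij; rewrite ffunE; exact: h.
rewrite (_ : (fun s => _) = fun s => \sum_(c : {ffun 'I_m * 'I_m -> bool})
    \1_[set s | tbl s = c] s * (k%:R^-1 * \sum_(l < k) ys s (idx c l))).
  apply: measurable_sum => c; apply: measurable_funM.
    exact: measurable_indic.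
  by apply: measurable_funM => //; exact: measurable_sum.
apply/funext => s; rewrite (bigD1 (tbl s))//= ?indicE mem_set// mul1r.
rewrite [X in _ + X]big1 ?addr0; last first.
  by move=> c ct; rewrite indicE memNset ?mul0r//= => /eqP; rewrite eq_sym (negbTE ct).
rewrite /knn_estimator; congr (_ * _); apply: eq_bigr => l _.
by rewrite -idxE.
Qed.

End measurable_knn.

(** * Iterated integrals under independence *)

Section independent_pair.
Context dA (A : measurableType dA) dB (B : measurableType dB).
Context dO (Omega : measurableType dO) (R : realType) (P : probability Omega R).
Variables (V : {RV P >-> A}) (W : {RV P >-> B}).
Local Open Scope ereal_scope.
Hypothesis VW : forall E F, measurable E -> measurable F ->
  P (V @^-1` E `&` W @^-1` F) = P (V @^-1` E) * P (W @^-1` F).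

Let U : {RV P >-> (A * B)%type} :=
  mfun_Sub (mem_set (measurable_fun_pair (measurable_funPT V) (measurable_funPT W))).

Lemma distribution_independent_pair D : measurable D ->
  (distribution P V \x distribution P W) D = distribution P U D.
Proof.
by apply: product_measure_unique => E F mE mF; rewrite -VW.
Qed.

(** Tonelli for the product of the two laws, transported back to [Omega]: independence shows up as
    two separate sample points [w] and [w'], without any product of sample spaces. *)
Lemma ge0_integral_independent_pair (Phi : A * B -> \bar R) :
  measurable_fun setT Phi -> (forall z, 0 <= Phi z) ->
  \int[P]_w Phi (V w, W w) = \int[P]_w \int[P]_w' Phi (V w, W w').
Proof.
move=> mPhi Phi0.
transitivity (\int[distribution P U]_z Phi z).
  by rewrite ge0_integral_distribution.
rewrite -(eq_measure_integral _ (fun D mD _ => distribution_independent_pair mD)).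
rewrite fubini_tonelli1// ge0_integral_distribution//; last 2 first.
- exact: measurable_fun_fubini_tonelli_F.
- by move=> a; apply: integral_ge0.
apply: eq_integral => w _ /=; rewrite /fubini_F.
rewrite ge0_integral_distribution//.
by apply: measurableT_comp => //; exact: measurable_pair1.
Qed.

(** Integrating first in [W] leaves a multiple of the mean of [h (W w)], which is zero. The sign is
    arbitrary, so Fubini asks for integrability of the product. This is what kills the cross terms
    between residuals. *)
Lemma integral_independent_mul0 (g : A -> R) (h : B -> R) :
  measurable_fun setT g -> measurable_fun setT h ->
  P.-integrable setT (fun w => (g (V w) * h (W w))%:E) ->
  \int[P]_w (h (W w))%:E = 0 -> P.-integrable setT (fun w => (h (W w))%:E) ->
  \int[P]_w (g (V w) * h (W w))%:E = 0.
Proof.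
move=> mg mh intgh h0 inth.
pose Phi (z : A * B) := (g z.1 * h z.2)%:E.
have mPhi : measurable_fun setT Phi.
  apply/measurable_EFinP; apply: measurable_funM.
    exact: measurableT_comp mg measurable_fst.
  exact: measurableT_comp mh measurable_snd.
transitivity (\int[distribution P U]_z Phi z).
  by rewrite integral_distribution.
have intPhi : (distribution P V \x distribution P W).-integrable setT Phi.
  apply/integrableP; split => //.
  rewrite (eq_measure_integral _ (fun D mD _ => distribution_independent_pair mD)).
  have /integrableP[_] := intgh.
  rewrite ge0_integral_distribution//.
  exact: measurableT_comp.
rewrite -(eq_measure_integral _ (fun D mD _ => distribution_independent_pair mD)).
rewrite -integral12_prod_meas1//.
rewrite (eq_integral (cst 0)) ?integral_cst ?mul0e// => a _.
rewrite /fubini_F /Phi/=.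
under eq_integral do rewrite EFinM.
have mhE : measurable_fun setT (EFin \o h) by exact/measurable_EFinP.
have inthW : (distribution P W).-integrable setT (EFin \o h).
  exact: integrable_pushforward.
rewrite integralZl//.
by rewrite integral_distribution// [X in _ * X](_ : _ = 0) ?mule0.
Qed.

End independent_pair.

Lemma measurable_integral_rv dA (A : measurableType dA) dB (B : measurableType dB)
    dO (Omega : measurableType dO) (R : realType) (P : probability Omega R)
    (Z : {RV P >-> B}) (Phi : A * B -> \bar R) :
  measurable_fun setT Phi -> (forall z, 0 <= Phi z)%E ->
  measurable_fun setT (fun a => \int[P]_w Phi (a, Z w))%E.
Proof.
move=> mPhi Phi0.
rewrite (_ : (fun a => _) = fubini_F (distribution P Z) Phi).
  exact: measurable_fun_fubini_tonelli_F.
apply/funext => z; rewrite /fubini_F ge0_integral_distribution//.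
by apply: measurableT_comp => //; exact: measurable_pair1.
Qed.

Section independent_triple.
Context dA (A : measurableType dA) dB (B : measurableType dB).
Context dC (C : measurableType dC).
Context dO (Omega : measurableType dO) (R : realType) (P : probability Omega R).
Variables (V : {RV P >-> A}) (W : {RV P >-> B}) (Z : {RV P >-> C}).
Local Open Scope ereal_scope.
Hypothesis VWZ : forall E F G, measurable E -> measurable F -> measurable G ->
  P (V @^-1` E `&` W @^-1` F `&` Z @^-1` G) =
  P (V @^-1` E) * P (W @^-1` F) * P (Z @^-1` G).

(** The pair [(V, W)] has to be shown independent of [Z], while the hypothesis only concerns
    rectangles. If [Z] lies in [G] with positive probability, the conditional law [nu] of the pair
    given this event agrees with the product of the laws on rectangles, hence everywhere. If the
    probability is zero, both sides vanish. *)
Lemma ge0_integral_independent_triple (Phi : A * B * C -> \bar R) :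
  measurable_fun setT Phi -> (forall z, 0 <= Phi z) ->
  \int[P]_w Phi (V w, W w, Z w) =
  \int[P]_w \int[P]_w' \int[P]_w'' Phi (V w, W w', Z w'').
Proof.
move=> mPhi Phi0.
have VW E F : measurable E -> measurable F ->
    P (V @^-1` E `&` W @^-1` F) = P (V @^-1` E) * P (W @^-1` F).
  move=> mE mF; have := VWZ mE mF measurableT.
  by rewrite preimage_setT setIT probability_setT mule1.
pose mU := measurable_fun_pair (measurable_funPT V) (measurable_funPT W).
pose U : {RV P >-> (A * B)%type} := mfun_Sub (mem_set mU).
have UZ D G : measurable D -> measurable G ->
    P (U @^-1` D `&` Z @^-1` G) = P (U @^-1` D) * P (Z @^-1` G).
  move=> mD mG.
  have mZG : measurable (Z @^-1` G).
    by rewrite -[X in measurable X]setTI; exact: measurable_funPT.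
  have mUD : measurable (U @^-1` D).
    by rewrite -[X in measurable X]setTI; exact: measurable_funPT.
  have [ZG0|ZG0] := eqVneq (P (Z @^-1` G)) 0.
    rewrite ZG0 mule0; apply/eqP; rewrite eq_le measure_ge0 andbT -ZG0.
    by rewrite le_measure ?inE//; exact: measurableI.
  pose c := fine (P (Z @^-1` G)).
  have cE : P (Z @^-1` G) = c%:E by rewrite fineK// fin_num_measure.
  have c0 : c != 0%R by move: ZG0; rewrite cE eqe.
  have ci0 : (0 <= c^-1)%R by rewrite invr_ge0 fine_ge0.
  pose ci : {nonneg R} := NngNum ci0.
  pose nu0 : {measure set (A * B)%type -> \bar R} :=
    measure_function_pushforward__canonical__measure_function_Measure
      (mrestr P mZG) (measurable_funPT U).
  pose nu := mscale ci nu0.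
  have nuE X : nu X = c^-1%:E * P (U @^-1` X `&` Z @^-1` G) by [].
  have nuD : (distribution P V \x distribution P W) D = nu D.
    apply: product_measure_unique mD => E F mE mF.
    rewrite -[LHS]/(nu (E `*` F)) nuE.
    rewrite (_ : U @^-1` _ = V @^-1` E `&` W @^-1` F)// VWZ//.
    rewrite cE muleC -muleA -EFinM divff// mule1//.
  move: nuD; rewrite distribution_independent_pair// nuE.
  move=> e; rewrite [P (U @^-1` D)]e cE muleAC -EFinM mulVf// mul1e//.
transitivity (\int[P]_w \int[P]_w' Phi (U w, Z w')).
  exact: (ge0_integral_independent_pair UZ).
pose Psi z := \int[P]_w' Phi (z, Z w').
have mPsi : measurable_fun setT Psi by exact: measurable_integral_rv.
rewrite (ge0_integral_independent_pair VW (Phi := Psi))// => z.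
exact: integral_ge0.
Qed.

End independent_triple.

(** * Second moments of sums of uncorrelated variables *)

Section square_integrable.
Context d (T : measurableType d) (R : realType) (P : probability T R).
Implicit Types f g : T -> R.

Lemma integrable_mul_sqr f g :
  measurable_fun setT f -> measurable_fun setT g ->
  P.-integrable setT (fun x => (f x ^+ 2)%:E) ->
  P.-integrable setT (fun x => (g x ^+ 2)%:E) ->
  P.-integrable setT (fun x => (f x * g x)%:E).
Proof.
move=> mf mg if2 ig2.
apply: (le_integrable measurableT _ _ (integrableD measurableT if2 ig2)).
  by apply/measurable_EFinP; exact: measurable_funM.
move=> x _ /=; rewrite lee_fin [leRHS]ger0_norm ?addr_ge0 ?sqr_ge0//.
rewrite normrM -(real_normK (num_real (f x))) -(real_normK (num_real (g x))).
by have := normr_ge0 (f x); have := normr_ge0 (g x); nra.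
Qed.

Lemma integrable_of_sqr f : measurable_fun setT f ->
  P.-integrable setT (fun x => (f x ^+ 2)%:E) ->
  P.-integrable setT (fun x => (f x)%:E).
Proof.
move=> mf if2; have := integrable_mul_sqr mf (measurable_cst (1 : R)) if2.
under eq_fun do rewrite expr1n.
move=> /(_ (finite_measure_integrable_cst _ 1 measurableT)).
by under eq_fun do rewrite mulr1.
Qed.

Lemma integrable_sqrD f g :
  measurable_fun setT f -> measurable_fun setT g ->
  P.-integrable setT (fun x => (f x ^+ 2)%:E) ->
  P.-integrable setT (fun x => (g x ^+ 2)%:E) ->
  P.-integrable setT (fun x => ((f x + g x) ^+ 2)%:E).
Proof.
move=> mf mg if2 ig2.
have ifg := integrable_mul_sqr mf mg if2 ig2.
have := integrableD measurableT (integrableD measurableT if2 ig2)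
  (integrableZl measurableT 2 ifg).
apply: eq_integrable => // x _ /=.
by rewrite -EFinM -!EFinD; congr (_%:E); ring.
Qed.

Lemma integral_sqr_sum_le (Y : nat -> T -> R) (v : R) (J : seq nat) :
  (forall j, measurable_fun setT (Y j)) ->
  (forall j, P.-integrable setT (fun x => (Y j x ^+ 2)%:E)) ->
  (forall j, (\int[P]_x (Y j x ^+ 2)%:E <= v%:E)%E) ->
  (forall i j, i != j -> (\int[P]_x (Y i x * Y j x)%:E = 0)%E) ->
  uniq J ->
  (\int[P]_x ((\sum_(j <- J) Y j x) ^+ 2)%:E <= ((size J)%:R * v)%:E)%E.
Proof.
move=> mY iY Yv Y0.
pose S J x := \sum_(j <- J) Y j x.
have mS I : measurable_fun setT (S I) by exact: measurable_sum.
have iS I : P.-integrable setT (fun x => (S I x ^+ 2)%:E).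
  elim: I => [|a I IH].
    rewrite (_ : (fun x => _) = EFin \o cst (0 : R)).
      exact: finite_measure_integrable_cst.
    by apply/funext => x /=; rewrite /S big_nil expr0n.
  rewrite (_ : (fun x => _) = fun x => ((Y a x + S I x) ^+ 2)%:E).
    exact: integrable_sqrD.
  by apply/funext => x; rewrite /S big_cons.
have YS0 a I : a \notin I -> (\int[P]_x (Y a x * S I x)%:E = 0)%E.
  elim: I => [_|b I IH].
    rewrite (eq_integral (cst 0%E)) ?integral0// => x _.
    by rewrite /S big_nil mulr0.
  rewrite inE negb_or => /andP[ab aI].
  rewrite (eq_integral (fun x => (Y a x * Y b x)%:E + (Y a x * S I x)%:E)%E).
    rewrite integralD//; last 2 first.
      exact: integrable_mul_sqr.
    exact: integrable_mul_sqr.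
    by rewrite IH// Y0// adde0.
  by move=> x _; rewrite /S big_cons mulrDr.
elim: J => [_|a J IH /= /andP[aJ uJ]].
  rewrite (eq_integral (cst 0%E)) ?integral0 ?mul0r// => x _.
  by rewrite big_nil expr0n.
rewrite (eq_integral (fun x => ((Y a x ^+ 2)%:E +
    (2%:E * (Y a x * S J x)%:E + (S J x ^+ 2)%:E)))%E); last first.
  move=> x _; rewrite big_cons -/(S J x) -EFinM -!EFinD; congr (_%:E); ring.
have iYS := integrable_mul_sqr (mY a) (mS J) (iY a) (iS J).
have i2YS := integrableZl measurableT 2 iYS.
rewrite integralD//; last exact: integrableD.
rewrite integralD// integralZl// YS0// mule0 add0e -natr1 mulrDl mul1r addrC EFinD.
by rewrite leeD// IH.
Qed.

End square_integrable.

(** * Transfer between random variables and their laws; finite independence *)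

Section laws.
Context dT (T : measurableType dT) dO (Omega : measurableType dO) (R : realType).
Context (P : probability Omega R).
Local Open Scope ereal_scope.

Lemma ge0_integral_law (X : {RV P >-> T}) (mu : probability T R) (g : T -> \bar R) :
  has_law X mu -> measurable_fun setT g -> (forall t, 0 <= g t) ->
  \int[P]_w g (X w) = \int[mu]_t g t.
Proof.
move=> Xmu mg g0; rewrite -(ge0_integral_distribution X)//.
by apply: eq_measure_integral => A mA _; exact: Xmu.
Qed.

Lemma integrable_law (X : {RV P >-> T}) (mu : probability T R) (g : T -> \bar R) :
  has_law X mu -> mu.-integrable setT g -> P.-integrable setT (fun w => g (X w)).
Proof.
move=> Xmu /integrableP[mg gy]; apply/integrableP; split.
  exact: measurableT_comp.
rewrite (ge0_integral_law Xmu (g := fun t => `|g t|))//.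
exact: measurableT_comp.
Qed.

Lemma integral_law (X : {RV P >-> T}) (mu : probability T R) (g : T -> \bar R) :
  has_law X mu -> mu.-integrable setT g ->
  \int[P]_w g (X w) = \int[mu]_t g t.
Proof.
move=> Xmu ig; have /integrableP[mg _] := ig.
rewrite -(integral_distribution (X := X))//; last exact: integrable_law ig.
by apply: eq_measure_integral => A mA _; exact: Xmu.
Qed.

Lemma negligible_law (X : {RV P >-> T}) (mu : probability T R) (A : set T) :
  has_law X mu -> mu.-negligible A -> P.-negligible (X @^-1` A).
Proof.
move=> Xmu [B [mB B0 AB]]; exists (X @^-1` B); split.
- by rewrite -[X in measurable X]setTI; exact: measurable_funPT.
- by rewrite -B0 -Xmu.
- exact: preimage_subset.
Qed.

Lemma iid_pair (X : nat -> {RV P >-> T}) (mu : probability T R) i j E F :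
  iid_law X mu -> i != j -> measurable E -> measurable F ->
  P (X i @^-1` E `&` X j @^-1` F) = P (X i @^-1` E) * P (X j @^-1` F).
Proof.
move=> [indX _] ij mE mF.
pose A l := X l @^-1` (if l == i then E else F).
have := indX [fset l in [:: i; j]]%fset A.
have pe : perm_eq [fset l in [:: i; j]]%fset [:: i; j].
  apply: uniq_perm => [||l]; first exact: fset_uniq.
    by rewrite cons_uniq mem_seq1 ij.
  by rewrite !inE orbF.
rewrite (perm_big _ pe)/= 2!big_cons big_nil mule1.
have -> : A i = X i @^-1` E by rewrite /A eqxx.
have -> : A j = X j @^-1` F by rewrite /A eq_sym (negbTE ij).
move=> <-; last first.
  move=> l _; exists (if l == i then E else F); first by case: ifP.
  by rewrite setTI.
congr (P _); apply/seteqP; split => w /=.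
  move=> [Ei Fj] l /=; rewrite !inE orbF /A => /orP[/eqP ->|/eqP ->].
    by rewrite /= eqxx.
  by rewrite /= eq_sym (negbTE ij).
move=> h; split.
  by have := h i; rewrite /A/= eqxx; apply; rewrite !inE eqxx.
have := h j; rewrite /A/= eq_sym (negbTE ij); apply.
by rewrite !inE eqxx orbT.
Qed.

End laws.

Lemma independent3 {R : realType} dO (Omega : measurableType dO)
    (P : probability Omega R) (S1 S2 S3 : set (set Omega)) (E F G : set Omega) :
  independent P (tnth [tuple S1; S2; S3]) -> S1 E -> S2 F -> S3 G ->
  P (E `&` F `&` G) = (P E * P F * P G)%E.
Proof.
move=> ind SE SF SG.
have := ind [fset i in enum 'I_3]%fset (tnth [tuple E; F; G]).
have pe : perm_eq [fset i in enum 'I_3]%fset (enum 'I_3).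
  by apply: uniq_perm; rewrite ?fset_uniq ?enum_uniq// => i; rewrite !inE.
rewrite (perm_big _ pe)/= big_enum/= !big_ord_recl big_ord0 mule1 muleA.
move=> <-.
  congr (P _); apply/seteqP; split => w /=.
    move=> [[Ew Fw] Gw] i _.
    by case: i => -[|[|[|//]]] i; rewrite (tnth_nth set0).
  move=> h; split; first split.
  - by apply: (h ord0); rewrite /= !inE mem_enum.
  - by apply: (h (lift ord0 ord0)); rewrite /= !inE mem_enum.
  - by apply: (h (lift ord0 (lift ord0 ord0))); rewrite /= !inE mem_enum.
by move=> i _; case: i => -[|[|[|//]]] i; rewrite !(tnth_nth set0).
Qed.

Section sequence_space.
Context dT (T : measurableType dT) dO (Omega : measurableType dO) (R : realType).
Context (P : probability Omega R) (X : nat -> {RV P >-> T}).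

(* The sample space with the sigma-algebra generated by the sequence: it
   serves as the state space of the sequence seen as one random element. *)
Definition seq_space := g_sigma_algebraType (\bigcup_j sigma_rv (X j)).

Lemma measurable_seq_id : measurable_fun [set: Omega] (fun w : Omega => w : seq_space).
Proof.
move=> _ B mB; rewrite setTI; move: B mB.
apply: smallest_sub; first exact: sigma_algebra_measurable.
by move=> A [j _ [B mB <-]]; exact: (measurable_funPT (X j) measurableT _ mB).
Qed.

Definition seq_rv : {RV P >-> seq_space} := mfun_Sub (mem_set measurable_seq_id).

Lemma measurable_seq_coord j : measurable_fun [set: seq_space] (fun w : seq_space => X j w).
Proof.
by move=> _ B mB; apply: sub_sigma_algebra; exists j => //; exists B.
Qed.

End sequence_space.

(** * Regression function and residuals *)

Section regression_theory.
Context {R : realType} {d : nat} (N : 'rV[R]_d -> R).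
Hypothesis N_norm : is_norm N.
Context dT (Theta : measurableType dT) (f : 'rV[R]_d * Theta -> R).
Hypothesis f_meas : measurable_fun setT f.
Context (muX' : probability 'rV[R]_d R) (muT : probability Theta R).
Variables (L sigma : R).
Hypothesis f_lip : forall x x' theta, `|f (x, theta) - f (x', theta)| <= L * N (x - x').
Hypothesis f_var : forall x, msupport N muX' x ->
  ('V_muT[fun theta => f (x, theta)] <= (sigma ^+ 2)%:E)%E.

Local Notation r := (regression muT f).

Lemma measurable_f_section x : measurable_fun setT (fun theta => f (x, theta)).
Proof. exact: (measurableT_comp f_meas (measurable_pair1 x)). Qed.

Let mfr x : measurable_fun setT (fun theta => f (x, theta) - r x).
Proof. by apply: measurable_funB => //; exact: measurable_f_section. Qed.

Lemma integral_sqr_residual_le x : msupport N muX' x ->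
  (\int[muT]_theta ((f (x, theta) - r x) ^+ 2)%:E <= (sigma ^+ 2)%:E)%E.
Proof.
(* The variance is the integral of the squared deviation from [fine] of the expectation, which is
   [regression] as it stands, even before the expectation is known to be finite. *)
by move=> /f_var; rewrite /variance /regression unlock unlock.
Qed.

Lemma integrable_sqr_residual x : msupport N muX' x ->
  muT.-integrable setT (fun theta => ((f (x, theta) - r x) ^+ 2)%:E).
Proof.
move=> sx; apply/integrableP; split.
  by apply/measurable_EFinP; exact: measurable_funX.
under eq_integral do rewrite gee0_abs ?lee_fin ?sqr_ge0//.
by rewrite (le_lt_trans (integral_sqr_residual_le sx))// ltry.
Qed.

Lemma msupport_neq0 : msupport N muX' !=set0.
Proof.
apply/set0P/negP => /eqP s0; have := msupport_negligible N_norm muX'.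
rewrite s0 setC0 => /(negligibleP _ measurableT) e.
by have := probability_setT muX'; rewrite [LHS]e => /esym/eqP; rewrite onee_eq0.
Qed.

(** The variance bound gives integrability only at points of the support, of which at least one
    exists; the Lipschitz bound, uniform in [theta], carries it over to every [x]. *)
Lemma integrable_f_section x : muT.-integrable setT (fun theta => (f (x, theta))%:E).
Proof.
have [x0 sx0] := msupport_neq0.
have i0 := integrable_of_sqr (mfr x0) (integrable_sqr_residual sx0).
have ic := finite_measure_integrable_cst muT (`|r x0| + L * N (x - x0)) measurableT.
apply: (le_integrable measurableT _ _
  (integrableD measurableT (integrable_abse i0) ic)).
  by apply/measurable_EFinP; exact: measurable_f_section.
move=> t _ /=; rewrite lee_fin [leRHS]ger0_norm; last first.
  by rewrite addr_ge0// addr_ge0// (le_trans _ (f_lip x x0 t)).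
rewrite -(subrK (f (x0, t)) (f (x, t))) (le_trans (ler_normD _ _))//.
rewrite -{2}(subrK (r x0) (f (x0, t))).
have := ler_normD (f (x0, t) - r x0) (r x0); have := f_lip x x0 t; lra.
Qed.

Lemma regressionE x : (\int[muT]_theta (f (x, theta))%:E = (r x)%:E)%E.
Proof.
rewrite /regression unlock fineK//.
exact: integrable_fin_num (integrable_f_section x).
Qed.

Lemma integral_residual x : (\int[muT]_theta (f (x, theta) - r x)%:E = 0)%E.
Proof.
under eq_integral do rewrite EFinB.
rewrite integralB//; last 2 first.
- exact: integrable_f_section.
- exact: finite_measure_integrable_cst.
by rewrite regressionE integral_cst//= probability_setT mule1 subee.
Qed.

Lemma regression_lipschitz x y : `|r x - r y| <= L * N (x - y).
Proof.
rewrite -lee_fin -abse_EFin EFinB -!regressionE -integralB//;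
  try exact: integrable_f_section.
apply: (le_trans (le_abse_integral _ _ _)) => //.
  apply: emeasurable_funB; apply/measurable_EFinP; exact: measurable_f_section.
apply: (@le_trans _ _ (\int[muT]_t (L * N (x - y))%:E)%E).
  apply: ge0_le_integral => //.
    apply: measurableT_comp => //; apply: emeasurable_funB;
      apply/measurable_EFinP; exact: measurable_f_section.
  by move=> t _; rewrite -EFinB abse_EFin lee_fin.
by rewrite integral_cst//= probability_setT mule1.
Qed.

Lemma measurable_regression : 0 <= L -> measurable_fun setT r.
Proof.
move=> L0; apply: (continuous_measurable_rV (g := r)).
exact: (lipschitz_is_norm_continuous N_norm L0 regression_lipschitz).
Qed.

Context dO (Omega : measurableType dO) (P : probability Omega R).
Context (T : nat -> {RV P >-> Theta}).
Hypothesis T_iid : iid_law T muT.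

(** At fixed design points the residuals are centered functions of the independent [T j], so
    products over distinct indices integrate to zero and only the variances remain. The points are
    taken in the support because the variance is bounded there. *)
Lemma integral_sqr_sum_residual_le (pts : nat -> 'rV[R]_d) (J : seq nat) :
  (forall j, msupport N muX' (pts j)) -> uniq J ->
  (\int[P]_w ((\sum_(j <- J) (f (pts j, T j w) - r (pts j))) ^+ 2)%:E <=
   ((size J)%:R * sigma ^+ 2)%:E)%E.
Proof.
move=> spts uJ; have [indT lawT] := T_iid.
pose g j theta := f (pts j, theta) - r (pts j).
have mg j : measurable_fun setT (g j) by exact: mfr.
have ig2 j : muT.-integrable setT (fun t => (g j t ^+ 2)%:E).
  exact: integrable_sqr_residual.
have ig j := integrable_of_sqr (mg j) (ig2 j).
apply: (integral_sqr_sum_le (Y := fun j w => g j (T j w))) => //.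
- by move=> j; exact: measurableT_comp.
- by move=> j; exact: (integrable_law (lawT j) (ig2 j)).
- move=> j; rewrite (integral_law (lawT j) (ig2 j)).
  exact: integral_sqr_residual_le.
move=> i j ij; apply: (integral_independent_mul0 (V := T i) (W := T j)) => //.
- by move=> E F mE mF; exact: iid_pair T_iid ij mE mF.
- apply: (integrable_mul_sqr (f := fun w => g i (T i w)) (g := fun w => g j (T j w))).
  + exact: measurableT_comp.
  + exact: measurableT_comp.
  + exact: (integrable_law (lawT i) (ig2 i)).
  + exact: (integrable_law (lawT j) (ig2 j)).
- by rewrite (integral_law (lawT j) (ig j)); exact: integral_residual.
- exact: (integrable_law (lawT j) (ig j)).
Qed.

End regression_theory.

(** * Mean square error *)

(** Cauchy-Schwarz with constant weights. In the inductive step the cross term is handled by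
    [(n * u a - S) ^ 2 >= 0] after multiplication by [n], whence the separate case of an empty
    tail. *)
Lemma sqr_sum_le {R : realDomainType} (I : Type) (J : seq I) (u : I -> R) :
  (\sum_(j <- J) u j) ^+ 2 <= (size J)%:R * \sum_(j <- J) u j ^+ 2.
Proof.
elim: J => [|a J IH]; first by rewrite !big_nil expr0n mul0r.
rewrite !big_cons /= -natr1.
set S := \sum_(j <- J) u j in IH *; set Q := \sum_(j <- J) u j ^+ 2 in IH *.
have Q0 : 0 <= Q by rewrite sumr_ge0// => j _; exact: sqr_ge0.
case: J @S @Q IH Q0 => [|b J] S Q IH Q0.
  by rewrite /S /Q !big_nil !addr0 add0r mul1r.
set n := (size (b :: J))%:R in IH *.
have n0 : 0 < n :> R by rewrite ltr0n.
have cs : n * (2 * u a * S) <= n * (n * u a ^+ 2 + Q).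
  have := sqr_ge0 (n * u a - S); nra.
by move: cs; rewrite ler_pM2l//; nra.
Qed.

Section mean_square_error.
Context {R : realType} {d : nat} (N : 'rV[R]_d -> R).
Hypotheses (d_gt0 : (0 < d)%N) (N_norm : is_norm N).
Context dT (Theta : measurableType dT) (f : 'rV[R]_d * Theta -> R).
Hypothesis f_meas : measurable_fun setT f.
Context (muX muX' : probability 'rV[R]_d R) (muT : probability Theta R).
Context dO (Omega : measurableType dO) (P : probability Omega R).
Context (X : {RV P >-> 'rV[R]_d}) (X' : nat -> {RV P >-> 'rV[R]_d}).
Context (T : nat -> {RV P >-> Theta}).
Hypotheses (X_law : has_law X muX) (X'_iid : iid_law X' muX').
Hypothesis T_iid : iid_law T muT.
Hypothesis indep :
  independent P (tnth [tuple sigma_rv X; sigma_rv_seq X'; sigma_rv_seq T]).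
Variables (L sigma : R).
Hypothesis L_ge0 : 0 <= L.
Hypothesis f_lip : forall x x' theta, `|f (x, theta) - f (x', theta)| <= L * N (x - x').
Hypothesis f_var : forall x, msupport N muX' x ->
  ('V_muT[fun theta => f (x, theta)] <= (sigma ^+ 2)%:E)%E.

Local Notation r := (regression muT f).
(** The query, the design and the label noise get separate sample points [w0], [w1], [w2], so that
    the three independent sources can be integrated one at a time; the actual error is the case
    [w0 = w1 = w2]. *)
Local Notation err m k w0 w1 w2 := (r (X w0) -
  knn_estimator N (fun j => X' j w1) (fun j => f (X' j w1, T j w2)) m (X w0) k).

Let Phi m k (z : 'rV[R]_d * seq_space X' * seq_space T) : \bar R :=
  ((r z.1.1 - knn_estimator N (fun j => X' j z.1.2)
    (fun j => f (X' j z.1.2, T j z.2)) m z.1.1 k) ^+ 2)%:E.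

Let mPhi m k : measurable_fun setT (Phi m k).
Proof.
have mX1 : measurable_fun setT
    (fun z : 'rV[R]_d * seq_space X' * seq_space T => z.1.1).
  exact: (measurableT_comp measurable_fst measurable_fst).
have mX'1 j : measurable_fun setT
    (fun z : 'rV[R]_d * seq_space X' * seq_space T => X' j z.1.2 : 'rV[R]_d).
  exact: (measurableT_comp (measurable_seq_coord (X := X') j)
    (measurableT_comp measurable_snd measurable_fst)).
have mT2 j : measurable_fun setT
    (fun z : 'rV[R]_d * seq_space X' * seq_space T => T j z.2).
  exact: (measurableT_comp (measurable_seq_coord (X := T) j) measurable_snd).
have mY j : measurable_fun setT
    (fun z : 'rV[R]_d * seq_space X' * seq_space T => f (X' j z.1.2, T j z.2)).
  exact: (measurableT_comp f_meas (measurable_fun_pair (mX'1 j) (mT2 j))).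
apply/measurable_EFinP; apply: measurable_funX; apply: measurable_funB.
  apply: (measurableT_comp _ mX1).
  exact: (measurable_regression N_norm f_meas f_lip f_var).
exact: (measurable_knn_estimator N_norm mX'1 mY mX1).
Qed.

Let Phi_ge0 m k z : (0 <= Phi m k z)%E.
Proof. by rewrite lee_fin sqr_ge0. Qed.

Let iterated_integral m k :
  (\int[P]_w ((err m k w w w) ^+ 2)%:E =
   \int[P]_w0 \int[P]_w1 \int[P]_w2 ((err m k w0 w1 w2) ^+ 2)%:E)%E.
Proof.
have indXX'T (E : set 'rV[R]_d) (F : set (seq_space X')) (G : set (seq_space T)) :
    measurable E -> measurable F -> measurable G ->
    P (X @^-1` E `&` seq_rv X' @^-1` F `&` seq_rv T @^-1` G) =
    (P (X @^-1` E) * P (seq_rv X' @^-1` F) * P (seq_rv T @^-1` G))%E.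
  move=> mE mF mG; apply: (independent3 indep) => //.
  by exists E => //; rewrite setTI.
exact: (ge0_integral_independent_triple indXX'T (mPhi m k) (@Phi_ge0 m k)).
Qed.

Let measurable_inner m k w0 :
  measurable_fun setT (fun w1 => \int[P]_w2 ((err m k w0 w1 w2) ^+ 2)%:E)%E.
Proof.
have mI := measurable_integral_rv (seq_rv T) (@mPhi m k) (@Phi_ge0 m k).
exact: (measurableT_comp mI
  (measurable_fun_pair (measurable_cst (X w0)) (measurable_funPT (seq_rv X')))).
Qed.

Let measurable_outer m k : measurable_fun setT
  (fun w0 => \int[P]_w1 \int[P]_w2 ((err m k w0 w1 w2) ^+ 2)%:E)%E.
Proof.
have mI := measurable_integral_rv (seq_rv T) (@mPhi m k) (@Phi_ge0 m k).
have mI2 := measurable_integral_rv (seq_rv X') mI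
  (fun z => integral_ge0 _ (fun w _ => @Phi_ge0 m k _)).
exact: (measurableT_comp mI2 (measurable_funPT X)).
Qed.

Local Notation blocks k s w0 w1 := (\sum_(b < k)
  \big[mine/+oo]_(j <- iota (b * s) s) (N (X w0 - X' j w1) ^+ 2)%:E)%E.

Lemma conditional_mse_le m k s w0 w1 :
  (0 < k)%N -> (0 < s)%N -> (k * s <= m)%N ->
  (forall j, msupport N muX' (X' j w1)) ->
  (\int[P]_w2 ((err m k w0 w1 w2) ^+ 2)%:E <=
   (2 * L ^+ 2 / k%:R)%:E * blocks k s w0 w1 + (2 * sigma ^+ 2 / k%:R)%:E)%E.
Proof.
move=> k0 s0 ksm suppX'.
have km : (k <= m)%N by rewrite (leq_trans _ ksm)// leq_pmulr.
have k0R : 0 < k%:R :> R by rewrite ltr0n.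
have N0 v : 0 <= N v by exact: is_norm_ge0.
set x := X w0; set pts := fun j => X' j w1.
(* The neighbors depend on [w0] and [w1] only, so this list stays fixed during the integration over
   [w2]. *)
pose J := nearest N pts m x k.
pose V w2 := \sum_(j <- J) (f (pts j, T j w2) - r (pts j)).
pose D := \sum_(j <- J) N (x - pts j) ^+ 2.
have D0 : 0 <= D by rewrite sumr_ge0// => j _; rewrite sqr_ge0.
have sJ : size J = k by exact: size_nearest.
have errE w2 : err m k w0 w1 w2 =
    k%:R^-1 * (\sum_(j <- J) (r x - r (pts j)) - V w2).
  rewrite knn_estimatorE// -/J /V !sumrB big_const_seq count_predT iter_addr_0 sJ.
  by rewrite opprB addrA subrK mulrBr -[r x *+ k]mulr_natl mulKf// gt_eqF.
have errle w2 : (err m k w0 w1 w2) ^+ 2 <=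
    2 * L ^+ 2 / k%:R * D + 2 / k%:R ^+ 2 * V w2 ^+ 2.
  rewrite errE; set B := \sum_(j <- J) _.
  have B2 : B ^+ 2 <= k%:R * (L ^+ 2 * D).
    rewrite (le_trans (sqr_sum_le _ _))// sJ ler_pM2l// mulr_sumr ler_sum// => j _.
    rewrite -exprMn -real_normK ?num_real// lerXn2r ?nnegrE ?mulr_ge0//.
    exact: (regression_lipschitz N_norm f_meas f_lip f_var).
  rewrite exprMn.
  (* A factor [2], later absorbed by the constant [C], spares the study of the cross term between
     bias and noise. *)
  have BV : (B - V w2) ^+ 2 <= 2 * (k%:R * (L ^+ 2 * D)) + 2 * V w2 ^+ 2.
    by have := sqr_ge0 (B + V w2); nra.
  rewrite (le_trans (ler_wpM2l _ BV)) ?sqr_ge0// le_eqVlt; apply/orP; left.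
  by apply/eqP; field; rewrite gt_eqF.
have mT j : measurable_fun setT (fun w2 => f (pts j, T j w2) - r (pts j)).
  apply: measurable_funB => //.
  exact: (measurableT_comp (measurable_f_section f_meas (pts j)) (measurable_funPT (T j))).
have mV2 : measurable_fun setT (fun w2 => (V w2 ^+ 2)%:E).
  by apply/measurable_EFinP; apply: measurable_funX; exact: measurable_sum.
have c0 : (0 <= (2 / k%:R ^+ 2 : R)%:E)%E by rewrite lee_fin divr_ge0// exprn_ge0// ltW.
apply: (@le_trans _ _ (\int[P]_w2 ((2 * L ^+ 2 / k%:R * D)%:E +
    (2 / k%:R ^+ 2)%:E * (V w2 ^+ 2)%:E))%E).
  apply: ge0_le_integral => //.
  - by move=> w2 _; rewrite lee_fin sqr_ge0.
  - have mc := measurable_cst ((x, w1) : 'rV[R]_d * seq_space X') (D := [set: Omega]).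
    have mpair := measurable_fun_pair mc (measurable_funPT (seq_rv T)).
    exact (measurableT_comp (mPhi m k) mpair).
  - by apply: emeasurable_funD => //; exact: emeasurable_funM.
  - by move=> w2 _; rewrite -EFinM -EFinD lee_fin.
have e0 : (0 <= (2 * L ^+ 2 / k%:R * D)%:E)%E.
  by rewrite lee_fin mulr_ge0// divr_ge0 ?mulr_ge0 ?sqr_ge0// ltW.
rewrite ge0_integralD//; last 2 first.
- by move=> w2 _; rewrite mule_ge0// lee_fin sqr_ge0.
- exact: emeasurable_funM.
rewrite integral_cst//= probability_setT mule1 ge0_integralZl//; last first.
  by move=> w2 _; rewrite lee_fin sqr_ge0.
apply: leeD.
  rewrite EFinM; apply: lee_wpmul2l.
    by rewrite lee_fin divr_ge0 ?mulr_ge0 ?sqr_ge0// ltW.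
  exact: sum_nearest_le_blocks.
apply: (@le_trans _ _ ((2 / k%:R ^+ 2)%:E * (k%:R * sigma ^+ 2)%:E)%E).
  apply: lee_wpmul2l => //; rewrite -{1}sJ.
  exact: (integral_sqr_sum_residual_le N_norm f_meas f_lip f_var T_iid _ (nearest_uniq _ _ _ _ _)).
rewrite -EFinM lee_fin le_eqVlt; apply/orP; left.
by apply/eqP; field; rewrite gt_eqF.
Qed.

Variables (U : set 'rV[R]_d) (p : 'rV[R]_d -> R) (kappa r_kappa : R).
Hypothesis suppX_U : msupport N muX `<=` U.
Hypotheses (mp : measurable_fun setT p) (p_ge0 : forall x, 0 <= p x).
Hypothesis p_gt0 : forall x, U x -> 0 < p x.
Hypotheses (kappa_gt0 : 0 < kappa) (r_kappa_gt0 : 0 < r_kappa).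
Hypothesis p_ball : forall x r, U x -> 0 <= r <= r_kappa ->
  ((kappa * p x)%:E * unit_ball_volume N * (r ^+ d)%:E
    <= muX' (norm_ball N x r))%E.

Lemma ae_X_U : {ae P, forall w, U (X w)}.
Proof.
have /(negligible_law X_law) := msupport_negligible N_norm muX.
by apply: negligibleS => w /= /[swap] sw; apply; exact: suppX_U.
Qed.

Lemma ae_X'_support : {ae P, forall w, forall j, msupport N muX' (X' j w)}.
Proof.
have [_ lawX'] := X'_iid.
have : P.-negligible (\bigcup_j X' j @^-1` (~` msupport N muX')).
  apply: negligible_bigcup => j; apply: (negligible_law (lawX' j)).
  exact: msupport_negligible.
by apply: negligibleS => w /= /existsNP[j sj]; exists j.
Qed.

(** [U] contains the nonempty support of [muX]. A ball of radius [r_kappa] centered in [U] has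
    probability at most [1], while the small-ball bound would make it infinite if the volume
    were. *)
Lemma unit_ball_volume_lty : (unit_ball_volume N < +oo)%E.
Proof.
have [x Ux] : U !=set0.
  have [x /suppX_U] := msupport_neq0 N_norm muX.
  by exists x.
have := p_ball Ux; move=> /(_ r_kappa); rewrite (ltW r_kappa_gt0) lexx => /(_ isT).
have := unit_ball_volume_gt0 N_norm.
case: (unit_ball_volume N) => [v _ _|_|//]; first by rewrite ltry.
rewrite gt0_muley ?lte_fin ?mulr_gt0 ?p_gt0//.
rewrite gt0_mulye ?lte_fin ?exprn_gt0// => h.
by have := le_trans h (probability_le1 muX' (measurable_norm_ball N_norm x r_kappa)).
Qed.

Variable m0 : nat.
Hypothesis m0_gt0 : (0 < m0)%N.
Hypothesis min_integrable :
  (\int[P]_w (\big[mine/+oo]_(j < m0) (N (X' j w))%:E) < +oo)%E.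
Hypothesis p_integrable :
  ('E_P[fun w => ((1 + N (X w) ^+ 2) / p (X w) `^ (2 / d%:R))%R] < +oo)%E.

Lemma knn_mse_le : exists2 D : R, 0 <= D & forall m k s : nat,
  (0 < k)%N -> (8 * m0 <= s)%N -> (k * s <= m)%N ->
  ('E_P[fun w => ((err m k w w w) ^+ 2)%R] <=
   (D / s%:R `^ (2 / d%:R) + 2 * sigma ^+ 2 / k%:R)%:E)%E.
Proof.
have [K K0 KP] := min_sqr_dist_le d_gt0 N_norm X'_iid m0_gt0 min_integrable r_kappa_gt0.
have v_gt0 := unit_ball_volume_gt0 N_norm.
have vE : unit_ball_volume N = (fine (unit_ball_volume N))%:E.
  by rewrite fineK// gt0_fin_numE// unit_ball_volume_lty.
set v := fine (unit_ball_volume N) in vE.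
have v0 : 0 < v by rewrite -lte_fin -vE.
pose h x := (1 + N x ^+ 2) / p x `^ (2 / d%:R).
have h0 x : 0 <= h x.
  by rewrite /h divr_ge0 ?powR_ge0// addr_ge0// sqr_ge0.
have mh : measurable_fun setT h.
  rewrite (_ : h = fun x => (1 + N x ^+ 2) * p x `^ (- (2 / d%:R))).
    apply: measurable_funM.
      by apply: measurable_funD => //; apply: measurable_funX; exact: measurable_is_norm.
    exact: (measurableT_comp (measurable_powR _) mp).
  by apply/funext => x; rewrite powRN.
have mhX : measurable_fun setT (fun w => h (X w)) by exact: measurableT_comp.
pose I := fine (\int[P]_w (h (X w))%:E)%E.
have IE : (\int[P]_w (h (X w))%:E)%E = I%:E.
  rewrite /I fineK// ge0_fin_numE; last by apply: integral_ge0 => w _; rewrite lee_fin.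
  by move: p_integrable; rewrite unlock.
have I0 : 0 <= I by rewrite fine_ge0// integral_ge0// => w _; rewrite lee_fin.
(* With this [c], the small-ball hypothesis at [x] takes the form required of [q = c * p x]. *)
pose c := kappa * v; have c0 : 0 < c by rewrite mulr_gt0.
pose D1 := 2 * L ^+ 2 * K / c `^ (2 / d%:R).
have D10 : 0 <= D1.
  by rewrite /D1 divr_ge0 ?powR_ge0// mulr_ge0// mulr_ge0// sqr_ge0.
exists (D1 * I); first exact: mulr_ge0.
move=> m k s k0 ms ksm.
have s0 : (0 < s)%N by rewrite (leq_trans _ ms)// muln_gt0.
have k0R : 0 < k%:R :> R by rewrite ltr0n.
have s0R : 0 < s%:R :> R by rewrite ltr0n.
pose E1 := D1 / s%:R `^ (2 / d%:R).
have E10 : 0 <= E1 by rewrite divr_ge0// powR_ge0.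
pose E2 := 2 * sigma ^+ 2 / k%:R.
have E20 : 0 <= E2 by rewrite /E2 divr_ge0// mulr_ge0// sqr_ge0.
have mB w0 (b : nat) : measurable_fun setT (fun w1 =>
    \big[mine/+oo]_(j <- iota (b * s) s) (N (X w0 - X' j w1) ^+ 2)%:E)%E.
  apply: measurable_bigmine => j; apply/measurable_EFinP; apply: measurable_funX.
  exact: measurable_is_norm_sub.
have B0 w0 w1 (b : nat) :
    (0 <= \big[mine/+oo]_(j <- iota (b * s) s) (N (X w0 - X' j w1) ^+ 2)%:E)%E.
  elim: (iota _ _) => [|j t IH]; first by rewrite big_nil leey.
  by rewrite big_cons le_min IH lee_fin sqr_ge0.
have bnd w0 : U (X w0) ->
    (\int[P]_w1 \int[P]_w2 ((err m k w0 w1 w2) ^+ 2)%:E <=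
     E1%:E * (h (X w0))%:E + E2%:E)%E.
  move=> Uw0.
  have q0 : 0 < c * p (X w0) by rewrite mulr_gt0// p_gt0.
  have ballw0 r : 0 <= r <= r_kappa ->
      ((c * p (X w0) * r ^+ d)%:E <= muX' (norm_ball N (X w0) r))%E.
    move=> /(p_ball Uw0); apply: le_trans.
    by rewrite vE -!EFinM lee_fin /c (mulrAC kappa v).
  have L2k0 : (0 <= (2 * L ^+ 2 / k%:R)%:E)%E.
    by rewrite lee_fin divr_ge0// mulr_ge0// sqr_ge0.
  have sB0 w1 : (0 <= blocks k s w0 w1)%E by apply: sume_ge0 => b _.
  have msB : measurable_fun setT (fun w1 => blocks k s w0 w1).
    exact: emeasurable_sum.
  apply: (@le_trans _ _ (\int[P]_w1 ((2 * L ^+ 2 / k%:R)%:E * blocks k s w0 w1 +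
      E2%:E))%E).
    apply: ae_ge0_le_integral => //.
    - by move=> w1 _; apply: integral_ge0 => w2 _; rewrite lee_fin sqr_ge0.
    - by move=> w1 _; rewrite adde_ge0// mule_ge0.
    - by apply: emeasurable_funD => //; exact: emeasurable_funM.
    (* The conditional bound asks for all design points in the support, which holds only almost
       surely. *)
    move: ae_X'_support; apply: filterS => w1 sw1 _.
    exact: conditional_mse_le.
  rewrite ge0_integralD//; last 2 first.
  - by move=> w1 _; rewrite mule_ge0.
  - exact: emeasurable_funM.
  rewrite integral_cst//= probability_setT mule1 leeD//.
  rewrite ge0_integralZl//.
  rewrite ge0_integral_sum//.
  pose M := K * (1 + N (X w0) ^+ 2) / (c * p (X w0) * s%:R) `^ (2 / d%:R).
  apply: (@le_trans _ _ ((2 * L ^+ 2 / k%:R)%:E * \sum_(b < k) M%:E)%E).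
    apply: lee_wpmul2l => //; apply: lee_sum => b _.
    have := KP (X w0) _ (iota (b * s) s) q0; rewrite size_iota.
    by apply => //; exact: iota_uniq.
  (* All [k] blocks receive the same bound [M], which cancels the factor [1 / k]; the powers of [c],
     [p (X w0)] and [s] then separate. *)
  rewrite sumEFin sumr_const card_ord -!EFinM lee_fin.
  rewrite /M /E1 /D1 /h powRM ?(ltW q0) ?(ltW s0R)// powRM ?(ltW c0)//.
  have ? : 0 < c `^ (2 / d%:R) by rewrite powR_gt0.
  have ? : 0 < p (X w0) `^ (2 / d%:R) by rewrite powR_gt0// p_gt0.
  have ? : 0 < s%:R `^ (2 / d%:R) :> R by rewrite powR_gt0.
  rewrite -[X in _ * X <= _]mulr_natl le_eqVlt; apply/orP; left; apply/eqP; field.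
  by rewrite !gt_eqF.
rewrite unlock iterated_integral.
apply: (@le_trans _ _ (\int[P]_w0 (E1%:E * (h (X w0))%:E + E2%:E))%E).
  apply: ae_ge0_le_integral => //.
  - move=> w0 _; apply: integral_ge0 => w1 _; apply: integral_ge0 => w2 _.
    by rewrite lee_fin sqr_ge0.
  - by move=> w0 _; rewrite -EFinM -EFinD lee_fin addr_ge0// mulr_ge0.
  - by apply: emeasurable_funD => //; apply: emeasurable_funM => //;
      exact/measurable_EFinP.
  by move: ae_X_U; apply: filterS => w0 Uw0 _; exact: bnd.
rewrite ge0_integralD//; last 2 first.
- by move=> w0 _; rewrite -EFinM lee_fin mulr_ge0.
- by apply: emeasurable_funM => //; exact/measurable_EFinP.
rewrite integral_cst//= probability_setT mule1 ge0_integralZl//; last 2 first.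
- exact/measurable_EFinP.
- by move=> w0 _; rewrite lee_fin.
by rewrite IE -EFinM -EFinD lee_fin lerD2r /E1 mulrAC.
Qed.

(** Finiteness follows from the moment hypothesis by [1 <= 1 + N x ^ 2]. Positivity, needed to
    divide by the moment when choosing [C], holds because [X] is almost surely in [U], where [p] is
    positive: a zero integral would make [False] hold almost surely. *)
Lemma inverse_density_moment : exists2 I : R, 0 < I &
  ('E_P[fun w => (1 / p (X w) `^ (2 / d%:R))%R] = I%:E)%E.
Proof.
pose g w := 1 / p (X w) `^ (2 / d%:R).
have g0 w : 0 <= g w by rewrite /g divr_ge0 ?powR_ge0.
have mg (b : R) : measurable_fun setT (fun w => b / p (X w) `^ (2 / d%:R)).
  under eq_fun do rewrite -powRN.
  apply: measurable_funM => //.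
  exact: (measurableT_comp (measurableT_comp (measurable_powR _) mp)
    (measurable_funPT X)).
have mgE : measurable_fun setT (fun w => (g w)%:E).
  by apply/measurable_EFinP; exact: (mg 1).
have mNX : measurable_fun setT (fun w => 1 + N (X w) ^+ 2).
  apply: measurable_funD => //; apply: measurable_funX.
  exact: (measurableT_comp (measurable_is_norm N_norm) (measurable_funPT X)).
have gle : (\int[P]_w (g w)%:E < +oo)%E.
  move: p_integrable; rewrite unlock; apply: le_lt_trans.
  apply: ge0_le_integral => //.
  - by move=> w _; rewrite lee_fin.
  - apply/measurable_EFinP; apply: measurable_funM => //.
    by have := mg 1; under eq_fun do rewrite div1r.
  move=> w _; rewrite lee_fin ler_wpM2r ?invr_ge0 ?powR_ge0//.
  by rewrite lerDl sqr_ge0.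
have gE : (\int[P]_w (g w)%:E = (fine (\int[P]_w (g w)%:E))%:E)%E.
  by rewrite fineK// ge0_fin_numE// integral_ge0// => w _; rewrite lee_fin.
exists (fine (\int[P]_w (g w)%:E)%E); last by rewrite unlock -gE.
rewrite lt_neqAle fine_ge0 ?andbT; last first.
  by apply: integral_ge0 => w _; rewrite lee_fin.
apply/eqP => I0; have {}I0 : (\int[P]_w (g w)%:E = 0)%E by rewrite gE -I0.
have /(ae_eq_integral_abs P measurableT mgE) g_ae0 :
    (\int[P]_w `|(g w)%:E| = 0)%E.
  by rewrite -[RHS]I0; apply: eq_integral => w _; rewrite gee0_abs// lee_fin.
have : {ae P, forall w : Omega, False}.
  move: g_ae0 ae_X_U; apply: filterS2 => w /= /(_ I) [gw0] Uw.
  by move: (gw0) => /eqP; rewrite gt_eqF// /g divr_gt0// powR_gt0// p_gt0.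
move=> [B [mB B0 TB]]; have : P setT = 0%E.
  apply/eqP; rewrite eq_le measure_ge0 andbT -B0 le_measure ?inE// => w _.
  by apply: TB.
by rewrite probability_setT => /eqP; rewrite onee_eq0.
Qed.

End mean_square_error.

(** * Rates *)

Lemma limn_esup_le {R : realType} (u : (\bar R)^nat) (l : \bar R) :
  (\forall n \near \oo, (u n <= l)%E) -> (limn_esup u <= l)%E.
Proof.
move=> [M _ uM]; rewrite limn_esup_lim; apply: lime_le.
  exact: is_cvg_esups.
exists M => // n /= Mn; apply: ge_ereal_sup => _ [j /= nj <-].
by apply: uM; exact: leq_trans nj.
Qed.

Section rates.
Context {R : realType} (d : nat) (k : nat -> nat).
Local Notation alpha := (2 / (d + 2)%:R : R).
Hypothesis k_bounds : forall m, (1 <= m)%N -> (1 <= k m <= m)%N.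
Hypothesis k_small : (k m)%:R / m%:R @[m --> \oo] --> (0 : R).
Hypothesis k_equiv : (k m)%:R / m%:R `^ alpha @[m --> \oo] --> (1 : R).

(** By [k_equiv], [k m] eventually lies between [m ^ alpha / 2] and [2 * m ^ alpha]. Rounding the
    quotient down costs another factor [2], whence the [4]. By [k_small], blocks eventually exceed
    any prescribed length [c]. *)
Lemma block_size_rate (c : nat) : \forall m \near \oo,
  [/\ (0 < m)%N, m%:R `^ alpha / 2 <= (k m)%:R, (c <= m %/ k m)%N &
      m%:R `^ (1 - alpha) / 4 <= (m %/ k m)%:R].
Proof.
have e0 : 0 < (c.+1%:R)^-1 :> R by rewrite invr_gt0.
move/cvgrPdist_lt : k_small => /(_ _ e0) small.
have h0 : 0 < 2^-1 :> R by rewrite invr_gt0.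
move/cvgrPdist_lt : k_equiv => /(_ _ h0) equiv.
near=> m.
have m0 : (0 < m)%N by near: m; exact: nbhs_infty_gt.
have m0R : 0 < m%:R :> R by rewrite ltr0n.
have ma0 : 0 < m%:R `^ alpha :> R by rewrite powR_gt0.
have /andP[k1 km] := k_bounds m0.
have k0R : 0 < (k m)%:R :> R by rewrite ltr0n.
have km_lt : (k m)%:R / m%:R < (c.+1%:R)^-1 :> R.
  have : `|0 - (k m)%:R / m%:R| < (c.+1%:R)^-1 :> R by near: m.
  by rewrite sub0r normrN ger0_norm// divr_ge0.
have : `|1 - (k m)%:R / m%:R `^ alpha| < 2^-1 :> R by near: m.
rewrite ltr_norml => /andP[k_lo k_hi].
have k_le : (k m)%:R <= 2 * m%:R `^ alpha :> R.
  by rewrite -ler_pdivrMr//; lra.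
have k_ge : m%:R `^ alpha / 2 <= (k m)%:R :> R.
  by rewrite mulrC -ler_pdivlMr//; lra.
have mk : m%:R < (m %/ k m).+1%:R * (k m)%:R :> R.
  by rewrite -natrM ltr_nat ltn_ceil.
have cs : (c < m %/ k m)%N.
  rewrite -ltnS -(ltr_nat R) -(ltr_pM2r k0R).
  apply: le_lt_trans mk.
  move: km_lt; rewrite ltr_pdivrMr// mulrC ltr_pdivlMr// mulrC => /ltW.
  exact.
split => //; first exact: ltnW.
have s1 : (m %/ k m).+1%:R <= 2 * (m %/ k m)%:R :> R.
  by rewrite -natr1; have : 1 <= (m %/ k m)%:R :> R; [rewrite ler1n; case: (m %/ k m)%N cs|lra].
rewrite powRB; last by rewrite (gt_eqF m0R) implybT.
rewrite powRr1 ?ler0n//.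
rewrite ler_pdivrMr// ler_pdivrMr//.
apply: (le_trans (ltW mk)).
apply: (@le_trans _ _ ((2 * (m %/ k m)%:R) * (2 * m%:R `^ alpha))).
  by apply: ler_pM.
by rewrite le_eqVlt; apply/orP; left; apply/eqP; ring.
Unshelve. all: by end_near. Qed.

End rates.

Theorem theorem5p1
  (R : realType) (d : nat) (d_gt0 : (0 < d)%N)
  (N : 'rV[R]_d -> R) (N_norm : is_norm N)
  (dT : measure_display) (Theta : measurableType dT)
  (f : 'rV[R]_d * Theta -> R) (f_meas : measurable_fun setT f)
  (muX muX' : probability 'rV[R]_d R) (muT : probability Theta R)
  (dO : measure_display) (Omega : measurableType dO) (P : probability Omega R)
  (X : {RV P >-> 'rV[R]_d})
  (X' : nat -> {RV P >-> 'rV[R]_d})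
  (T : nat -> {RV P >-> Theta})
  (X_law : has_law X muX)
  (X'_iid : iid_law X' muX')
  (T_iid : iid_law T muT)
  (indep : independent P
     (tnth [tuple sigma_rv X; sigma_rv_seq X'; sigma_rv_seq T]))
  (min_integrable : exists m0 : nat, (0 < m0)%N /\
     (\int[P]_w (\big[mine/+oo]_(j < m0) (N (X' j w))%:E) < +oo)%E)
  (U : set 'rV[R]_d) (U_open : open U) (suppX_U : msupport N muX `<=` U)
  (p : 'rV[R]_d -> R)
  (p_density : is_density (fun A => muX' (A `&` U)) (lebesgue_rV R d) p)
  (p_cont : {within U, continuous p})
  (p_gt0 : forall x, U x -> 0 < p x)
  (p_ball : exists kappa r_kappa : R,
     [/\ 0 < kappa <= 1, 0 < r_kappa &
         forall x r, U x -> 0 <= r <= r_kappa ->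
         ((kappa * p x)%:E * unit_ball_volume N * (r ^+ d)%:E
            <= muX' (norm_ball N x r))%E])
  (p_integrable :
     ('E_P[fun w => ((1 + N (X w) ^+ 2) / p (X w) `^ (2 / d%:R))%R] < +oo)%E)
  (f_lip : exists L : R, 0 <= L /\
     forall x x' theta, `|f (x, theta) - f (x', theta)| <= L * N (x - x'))
  (sigma : R) (sigma_ge0 : 0 <= sigma)
  (f_var : forall x, msupport N muX' x ->
     ('V_muT[fun theta => f (x, theta)] <= (sigma ^+ 2)%:E)%E)
  (k : nat -> nat)
  (k_nondecr : forall m n, (1 <= m)%N -> (m <= n)%N -> (k m <= k n)%N)
  (k_bounds : forall m, (1 <= m)%N -> (1 <= k m <= m)%N)
  (k_small : (k m)%:R / m%:R @[m --> \oo] --> (0 : R))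
  (k_equiv : (k m)%:R / m%:R `^ (2 / (d + 2)%:R) @[m --> \oo] --> (1 : R)) :
  exists C : R, 0 <= C /\
    (limn_esup (fun m =>
       (m%:R `^ (1 / (2 + d)%:R))%:E *
       'E_P[fun w => ((regression muT f (X w) -
          knn_estimator N (fun j => X' j w) (fun j => f (X' j w, T j w))
            m (X w) (k m)) ^+ 2)%R] `^ (1 / 2))
     <= sigma%:E +
        C%:E * 'E_P[fun w => (1 / p (X w) `^ (2 / d%:R))%R] `^ (1 / 2))%E.
Proof.
have [m0 [m0_gt0 min_int]] := min_integrable.
have [kappa [r_kappa [/andP[kappa_gt0 _] r_kappa_gt0 p_ball']]] := p_ball.
have [L [L_ge0 f_lip']] := f_lip.
have [mp p_ge0 _] := p_density.
have [I I_gt0 IE] :=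
  inverse_density_moment N_norm X_law suppX_U mp p_gt0 p_integrable.
have [D D_ge0 mse] := knn_mse_le d_gt0 N_norm f_meas X_law X'_iid T_iid indep
  L_ge0 f_lip' f_var suppX_U mp p_ge0 p_gt0 kappa_gt0 r_kappa_gt0 p_ball'
  m0_gt0 min_int p_integrable.
pose alpha : R := 2 / (d + 2)%:R.
(* [B] bounds [m ^ alpha] times the mean square error: the [4] of the first term comes from the
   lower bound on the block size, and the [4 = 2 * 2] of the second from [k m >= m ^ alpha / 2]. *)
pose B := D * 4 `^ (2 / d%:R) + 4 * sigma ^+ 2.
have B_ge0 : 0 <= B.
  by rewrite addr_ge0 ?mulr_ge0 ?powR_ge0// sqr_ge0.
have d0 : d%:R != 0 :> R by rewrite pnatr_eq0 -lt0n.
have d20 : (d + 2)%:R != 0 :> R by rewrite pnatr_eq0 addn2.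
(* With this choice, [C] times the square root of the moment is the square root of [B]; adding the
   nonnegative [sigma] keeps the bound. *)
exists (B `^ (1 / 2) / I `^ (1 / 2)); split.
  by rewrite divr_ge0 ?powR_ge0.
rewrite IE poweR_EFin -EFinM divfK ?gt_eqF ?powR_gt0//.
apply: (@le_trans _ _ (B `^ (1 / 2))%:E); last first.
  by rewrite -EFinD lee_fin lerDr.
apply: limn_esup_le.
apply: filterS (block_size_rate k_bounds k_small k_equiv (8 * m0)) => m.
rewrite -/alpha => -[m_gt0 k_ge s_ge s_rate].
have m0R : 0 < m%:R :> R by rewrite ltr0n.
have ma_gt0 : 0 < m%:R `^ alpha :> R by rewrite powR_gt0.
have /andP[k1 km] := k_bounds m m_gt0.
have kR : 0 < (k m)%:R :> R by rewrite ltr0n.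
have s_gt0 : (0 < m %/ k m)%N by rewrite (leq_trans _ s_ge)// muln_gt0.
have sR : 0 < (m %/ k m)%:R :> R by rewrite ltr0n.
have ks : (k m * (m %/ k m) <= m)%N by rewrite mulnC leq_trunc_div.
have bias_rate : D / (m %/ k m)%:R `^ (2 / d%:R) <=
    D * 4 `^ (2 / d%:R) / m%:R `^ alpha.
  rewrite -mulrA ler_wpM2l//.
  have -> : 4 `^ (2 / d%:R) / m%:R `^ alpha =
      ((m%:R `^ (1 - alpha) / 4) `^ (2 / d%:R))^-1 :> R.
    rewrite powRM ?powR_ge0// -powRrM.
    (* [1 - alpha = d / (d + 2)], so the bias decays like [m ^ - alpha], the rate of [1 / k]: this
       is the balance behind the exponent [2 / (d + 2)]. *)
    have -> : (1 - alpha) * (2 / d%:R) = alpha.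
      by rewrite /alpha; move: d20; rewrite natrD => d20; field; rewrite d0 d20.
    by rewrite -(@powR_inv1 _ 4)// -powRrM mulN1r powRN invfM invrK mulrC.
  rewrite lef_pV2 ?posrE ?powR_gt0 ?divr_gt0 ?powR_gt0//.
  apply: ge0_ler_powR; rewrite ?nnegrE ?divr_ge0 ?powR_ge0 ?(ltW sR)//.
have var_rate : 2 * sigma ^+ 2 / (k m)%:R <= 4 * sigma ^+ 2 / m%:R `^ alpha.
  have -> : 4 * sigma ^+ 2 / m%:R `^ alpha =
      2 * sigma ^+ 2 / (m%:R `^ alpha / 2) by field; rewrite gt_eqF.
  rewrite ler_wpM2l ?mulr_ge0 ?sqr_ge0//.
  by rewrite lef_pV2 ?posrE ?divr_gt0.
have := mse m (k m) (m %/ k m)%N k1 s_ge ks.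
set E := 'E_P[_]%E => mse_m.
have {}mse_m : (E <= (B / m%:R `^ alpha)%:E)%E.
  by rewrite (le_trans mse_m)// lee_fin /B [leRHS]mulrDl lerD.
have E_ge0 : (0 <= E)%E by rewrite /E expectation_ge0// => w; exact: sqr_ge0.
apply: (@le_trans _ _ ((m%:R `^ (1 / (2 + d)%:R))%:E *
    (B / m%:R `^ alpha)%:E `^ (1 / 2))%E).
  apply: lee_wpmul2l; first by rewrite lee_fin powR_ge0.
  by apply: gt0_ler_poweR; rewrite ?in_itv/= ?leey ?andbT// (le_trans E_ge0).
rewrite poweR_EFin -EFinM lee_fin powRM ?invr_ge0 ?powR_ge0//.
rewrite -powRN -powRrM (_ : - alpha * (1 / 2) = - (1 / (2 + d)%:R)); last first.
  rewrite /alpha addnC; field.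
  by [].
by rewrite powRN mulrCA divff ?mulr1// gt_eqF// powR_gt0.
Qed.
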